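(* Let $G$ be a $\delta$-hyperbolic graph with $n$ vertices and $m$ edges. There exists an algorithm that finds points $c_1,c_2\in A(G)$ such that $\{c_1,c_2\}$ $(r_2+\delta)$-dominates $V(G)$, where $r_2$ is the $2$-radius of $V(G)$. This algorithm requires time $O((2\delta+1)(m+n))$.
   Context: Each edge of the finite undirected graph $G$ is a unit-length segment. $A(G)$ is the set of points of $G$, and $d$ is the shortest-path distance on $A(G)$. A geodesic triangle $\Delta(x,y,z)$ is a union of shortest paths $[x,y],[y,z],[x,z]$, and $[x,y][t]$ is the point of $[x,y]$ at distance $t$ from $x$. Set $\pi=\frac12(d(x,y)+d(y,z)+d(x,z))$, $\alpha_x=\pi-d(y,z)$, $\alpha_y=\pi-d(x,z)$ and $\alpha_z=\pi-d(x,y)$. The insize is the maximum over the three corners of $\max_{\theta\in[0,\alpha_x]} d([x,y][\theta],[x,z][\theta])$ and the analogous quantities at $y$ and $z$. $G$ is $\delta$-hyperbolic if all geodesic triangles have insize at most $\delta$, with $\delta$ the least such constant. A set $C$ $r$-dominates $V(G)$ if every vertex is within distance $r$ of some point of $C$. $r_2$ is the minimum $r$ such that some set of at most $2$ points of $A(G)$ $r$-dominates $V(G)$. *)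

(* Defs.v *)
From HB Require Import structures.
From mathcomp Require Import all_boot all_order all_algebra.
From mathcomp Require Import all_classical all_reals.

Set Implicit Arguments.
Unset Strict Implicit.
Unset Printing Implicit Defensive.

Import Order.TTheory GRing.Theory Num.Theory.

Local Open Scope classical_set_scope.
Local Open Scope ring_scope.

Definition simple_graph (T : finType) (e : rel T) : Prop :=
  symmetric e /\ irreflexive e.

Definition connected_graph (T : finType) (e : rel T) : Prop :=
  forall u v, connect e u v.

Definition num_edges (T : finType) (e : rel T) : nat :=
  #|[set [set p.1; p.2]%SET | p : T * T & e p.1 p.2]%SET|.

(** Points of A(G) are represented by their barycentric coordinates, as in the
    geometric realization of a simplicial complex; this makes the endpoints
    shared by several edges, and the two orientations of an edge, literally
    equal. [edge_point u v t] is the point at distance [t] from [u] on the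
    segment [uv]; [edge_point u u t] is the vertex [u]. *)
Definition edge_point (R : realType) (T : finType) (u v : T) (t : R) :
    {ffun T -> R} :=
  [ffun w => (1 - t) * (w == u)%:R + t * (w == v)%:R].

Definition vertex_point (R : realType) (T : finType) (u : T) : {ffun T -> R} :=
  edge_point u u 0.

(** A(G); the case [u = v] accounts for the vertex of a one-vertex graph. *)
Definition graph_points (R : realType) (T : finType) (e : rel T) :
    set {ffun T -> R} :=
  [set p | exists u v t,
     [/\ (u == v) || e u v, 0 <= t <= 1 & p = edge_point u v t]].

(** [walk e p q l]: a path of length [l] from [p] to [q], made of finitely many
    moves, each inside a single unit segment. *)
Inductive walk (R : realType) (T : finType) (e : rel T) :
    {ffun T -> R} -> {ffun T -> R} -> R -> Prop :=
| walk_nil p : graph_points e p -> walk e p p 0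
| walk_step u v s t q l :
    e u v -> 0 <= s <= 1 -> 0 <= t <= 1 ->
    walk e (edge_point u v t) q l ->
    walk e (edge_point u v s) q (`|s - t| + l).

Definition dist (R : realType) (T : finType) (e : rel T)
    (p q : {ffun T -> R}) : R :=
  inf [set l | walk e p q l].

(** A shortest path [x,y], parametrized by the distance from [x]; only the
    values of [g] on [0, d(x,y)] matter. *)
Definition geodesic (R : realType) (T : finType) (e : rel T)
    (x y : {ffun T -> R}) (g : R -> {ffun T -> R}) : Prop :=
  [/\ g 0 = x, g (dist e x y) = y,
      forall t, 0 <= t <= dist e x y -> graph_points e (g t) &
      forall s t, 0 <= s <= dist e x y -> 0 <= t <= dist e x y ->
        dist e (g s) (g t) = `|s - t|].

(** The supremum is a maximum whenever [f] and [g] are geodesics issued from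
    the same point, since [theta |-> d(f theta, g theta)] is then continuous. *)
Definition corner_size (R : realType) (T : finType) (e : rel T) (alpha : R)
    (f g : R -> {ffun T -> R}) : R :=
  sup [set dist e (f theta) (g theta) | theta in [set a | 0 <= a <= alpha]].

(** [gxy], [gyz], [gxz] are the sides [x,y], [y,z], [x,z]; [rev] reads a side
    from its other end. *)
Definition insize (R : realType) (T : finType) (e : rel T)
    (x y z : {ffun T -> R}) (gxy gyz gxz : R -> {ffun T -> R}) : R :=
  let d := dist e in
  let semi := (d x y + d y z + d x z) / 2 in
  let rev l (g : R -> {ffun T -> R}) := fun t => g (l - t) in
  Num.max (corner_size e (semi - d y z) gxy gxz)
    (Num.max (corner_size e (semi - d x z) (rev (d x y) gxy) gyz)
             (corner_size e (semi - d x y) (rev (d x z) gxz)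
                (rev (d y z) gyz))).

Definition thin_triangles (R : realType) (T : finType) (e : rel T)
    (delta : R) : Prop :=
  forall x y z gxy gyz gxz,
    graph_points e x -> graph_points e y -> graph_points e z ->
    geodesic e x y gxy -> geodesic e y z gyz -> geodesic e x z gxz ->
    insize e x y z gxy gyz gxz <= delta.

Definition is_minimum (R : realType) (S : set R) (r : R) : Prop :=
  S r /\ lbound S r.

Definition hyperbolic (R : realType) (T : finType) (e : rel T)
    (delta : R) : Prop :=
  is_minimum [set a | thin_triangles e a] delta.

Definition dominates (R : realType) (T : finType) (e : rel T)
    (C : set {ffun T -> R}) (r : R) : Prop :=
  forall v : T, exists2 c, C c & dist e (vertex_point R v) c <= r.

Definition is_radius (R : realType) (T : finType) (e : rel T)
    (k : nat) (r : R) : Prop :=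
  is_minimum
    [set a | exists C : set {ffun T -> R},
       [/\ C `<=` graph_points e, (C #<= `I_k)%card & dominates e C a]] r.

(** The machine model is a unit-cost random access machine with structured
    control. A program uses finitely many registers and finitely many arrays
    (each register and each array cell holds a natural number), all named by
    numbers. The only arithmetic is successor and predecessor, so a run of
    length [t] never creates a number exceeding by more than [t] the numbers
    of the input and the constants of the program: words of logarithmic size
    suffice for the unit cost to be realistic. *)
Record state := State { reg : nat -> nat; arr : nat -> nat -> nat }.

Definition set_reg (s : state) (x k : nat) : state :=
  State (fun y => if y == x then k else reg s y) (arr s).

Definition set_arr (s : state) (a i k : nat) : state :=
  State (reg s)
    (fun b j => if (b == a) && (j == i) then k else arr s b j).

Inductive cmd :=
| Skip
| Const of nat & nat        (* Const x k   : x := k *)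
| Move of nat & nat         (* Move x y    : x := y *)
| Succ of nat & nat         (* Succ x y    : x := y + 1 *)
| Pred of nat & nat         (* Pred x y    : x := max (y - 1) 0 *)
| ReadCell of nat & nat & nat   (* ReadCell x a y  : x := a[y] *)
| WriteCell of nat & nat & nat  (* WriteCell a x y : a[x] := y *)
| Seq of cmd & cmd
| IfLt of nat & nat & cmd & cmd  (* IfLt x y c1 c2 : if x < y then c1 else c2 *)
| WhileLt of nat & nat & cmd.    (* WhileLt x y c  : while x < y do c *)

(** [exec c s t s']: started in [s], the program [c] halts in [s'] after [t]
    unit steps; each basic instruction and each test costs one step. *)
Inductive exec : cmd -> state -> nat -> state -> Prop :=
| exec_skip s : exec Skip s 1 s
| exec_const x k s : exec (Const x k) s 1 (set_reg s x k)
| exec_move x y s : exec (Move x y) s 1 (set_reg s x (reg s y))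
| exec_succ x y s : exec (Succ x y) s 1 (set_reg s x (reg s y).+1)
| exec_pred x y s : exec (Pred x y) s 1 (set_reg s x (reg s y).-1)
| exec_read x a y s :
    exec (ReadCell x a y) s 1 (set_reg s x (arr s a (reg s y)))
| exec_write a x y s :
    exec (WriteCell a x y) s 1 (set_arr s a (reg s x) (reg s y))
| exec_seq c1 c2 s1 s2 s3 t1 t2 :
    exec c1 s1 t1 s2 -> exec c2 s2 t2 s3 -> exec (Seq c1 c2) s1 (t1 + t2)%N s3
| exec_if_true x y c1 c2 s s' t :
    (reg s x < reg s y)%N -> exec c1 s t s' -> exec (IfLt x y c1 c2) s t.+1 s'
| exec_if_false x y c1 c2 s s' t :
    (reg s y <= reg s x)%N -> exec c2 s t s' -> exec (IfLt x y c1 c2) s t.+1 s'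
| exec_while_true x y c s1 s2 s3 t1 t2 :
    (reg s1 x < reg s1 y)%N -> exec c s1 t1 s2 ->
    exec (WhileLt x y c) s2 t2 s3 -> exec (WhileLt x y c) s1 (t1 + t2).+1 s3
| exec_while_false x y c s :
    (reg s y <= reg s x)%N -> exec (WhileLt x y c) s 1 s.

Lemma exec_deterministic c s t s1 t' s2 :
  exec c s t s1 -> exec c s t' s2 -> t = t' /\ s1 = s2.
Proof.
move=> E; elim: E t' s2 => {c s t s1}.
- by move=> s t' s2 E; inversion E.
- by move=> x k s t' s2 E; inversion E.
- by move=> x y s t' s2 E; inversion E.
- by move=> x y s t' s2 E; inversion E.
- by move=> x y s t' s2 E; inversion E.
- by move=> x a y s t' s2 E; inversion E.
- by move=> a x y s t' s2 E; inversion E.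
- move=> c1 c2 s1 s2 s3 t1 t2 _ IH1 _ IH2 t' s' E; inversion E; subst.
  have [? ?] := IH1 _ _ ltac:(eassumption); subst.
  by have [? ?] := IH2 _ _ ltac:(eassumption); subst.
- move=> x y c1 c2 s s' t lt _ IH t' s2 E; inversion E; subst.
    by have [? ?] := IH _ _ ltac:(eassumption); subst.
  by move: lt; rewrite ltnNge => /negP.
- move=> x y c1 c2 s s' t le _ IH t' s2 E; inversion E; subst.
    by move: le; rewrite leqNgt => /negP.
  by have [? ?] := IH _ _ ltac:(eassumption); subst.
- move=> x y c s1 s2 s3 t1 t2 lt _ IH1 _ IH2 t' s' E; inversion E; subst.
    have [? ?] := IH1 _ _ ltac:(eassumption); subst.
    by have [? ?] := IH2 _ _ ltac:(eassumption); subst.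
  by move: lt; rewrite ltnNge => /negP.
- move=> x y c s le t' s2 E; inversion E; subst => //.
  by move: le; rewrite leqNgt => /negP.
Qed.

(** The neighbours of each vertex, listed in an arbitrary order. *)
Definition adjacency_lists (n : nat) (e : rel 'I_n) (adj : 'I_n -> seq 'I_n) :
    Prop :=
  forall v, uniq (adj v) /\ forall w, (w \in adj v) = e v w.

(** Input convention: register 0 holds [n]; array 1 is the concatenation of the
    adjacency lists of the vertices 0, ..., n-1, that of [v] starting at the
    index stored in cell [v] of array 0 and ending just before the index stored
    in cell [v + 1]. Everything else is 0. *)
Definition input_state (n : nat) (adj : 'I_n -> seq 'I_n) : state :=
  let lists := [seq [seq val w | w <- adj v] | v <- enum 'I_n] in
  State (fun x => if x == 0%N then n else 0%N)
        (fun a i => if a == 0%N then sumn (take i (shape lists))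
                    else if a == 1%N then nth 0%N (flatten lists) i
                    else 0%N).

(** Output convention: registers [k], ..., [k + 3] hold [u], [v], [a], [b],
    denoting the point at distance [a / b] from [u] on the edge [uv] (or the
    vertex [u] if [u = v]). *)
Definition output_point (R : realType) (n : nat) (e : rel 'I_n) (s : state)
    (k : nat) (c : {ffun 'I_n -> R}) : Prop :=
  exists u v : 'I_n,
    [/\ reg s k = val u, reg s k.+1 = val v, (u == v) || e u v,
        (0 < reg s k.+3)%N && (reg s k.+2 <= reg s k.+3)%N &
        c = edge_point u v ((reg s k.+2)%:R / (reg s k.+3)%:R)].

(* Main.v *)
Require Import Defs.
From mathcomp Require Import all_boot all_order all_algebra.
From mathcomp Require Import all_classical all_reals.
From mathcomp Require Import zify ring lra.

Set Implicit Arguments.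
Unset Strict Implicit.
Unset Printing Implicit Defensive.

Import Order.TTheory GRing.Theory Num.Theory.

Local Open Scope classical_set_scope.
Local Open Scope ring_scope.

(** Breadth-first searches are run, each from a vertex furthest from the
    previous root, until the eccentricity of the root stops growing. This ends
    with two vertices [x], [y], each furthest from the other. If [x0] is
    furthest from [z], thin triangles give
    [d(u,v) <= max(d(u,x0), d(v,x0)) + 2 delta] for all [u], [v], so the
    eccentricity is within [2 delta] of the diameter after the first search, and
    this takes at most [2 delta + 3] searches.

    Put [rho = max_v min(d(v,x), d(v,y))]. Among [v], [x], [y], two vertices are
    covered by the same optimal center, and [d(v,x) <= d(x,y)]; hence
    [rho <= 2 r2]. The centers are the points at distance [rho/2] from [x] and
    from [y] on shortest paths joining [x] and [y]. If [d(v,x) <= rho], compare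
    the center near [x] with the point of [x,v] at distance [rho/2] from [x] or,
    when [rho/2] exceeds [alpha_x] in the triangle [x,y,v], with the point of
    [y,v] at distance [d(x,y) - rho/2] from [y]; since [d(v,y) <= d(x,y)], both
    points are within [rho/2] of [v]. Neither [delta] nor [r2] need be known. *)

(** * The metric of a graph and its breadth-first trees *)

Section Metric.
Variables (R : realType) (T : finType) (e : rel T).
Implicit Types (u v w x y : T) (p q : {ffun T -> R}) (s t l : R).

Local Notation vp := (vertex_point R).
Local Notation A := (@graph_points R T e).

Lemma edge_point_loop u t : edge_point u u t = vp u.
Proof. by apply/ffunP => w; rewrite !ffunE; ring. Qed.

Lemma edge_point0 u v : edge_point u v 0 = vp u.
Proof. by apply/ffunP => w; rewrite !ffunE; ring. Qed.

Lemma edge_point1 u v : edge_point u v 1 = vp v.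
Proof. by apply/ffunP => w; rewrite !ffunE; ring. Qed.

Lemma vertex_in_graph u : A (vp u).
Proof. by exists u, u, 0; rewrite eqxx lexx ler01. Qed.

Lemma edge_point_in_graph u v t :
  (u == v) || e u v -> 0 <= t <= 1 -> A (edge_point u v t).
Proof. by move=> uv t01; exists u, v, t. Qed.

Lemma walk_ge0 p q l : walk e p q l -> 0 <= l.
Proof. by elim=> // *; exact: addr_ge0. Qed.

Lemma walk_cat p q r l1 l2 :
  walk e p q l1 -> walk e q r l2 -> walk e p r (l1 + l2).
Proof.
move=> W; elim: W r l2 => [{}p _ r l2|u v s t {}q l uv s01 t01 _ IH r l2 W2].
  by rewrite add0r.
by rewrite -addrA; apply: walk_step => //; exact: IH.
Qed.

(** The length is only bounded, because [walk_step] demands a genuine edge: if [u = v], both points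
    are one vertex and the walk is empty. *)
Lemma walk_edge u v s t : (u == v) || e u v -> 0 <= s <= 1 -> 0 <= t <= 1 ->
  exists2 l, walk e (edge_point u v s) (edge_point u v t) l & l <= `|s - t|.
Proof.
case: eqVneq => [->|_] /= uv s01 t01.
  exists 0 => //; rewrite !edge_point_loop.
  exact/walk_nil/vertex_in_graph.
exists (`|s - t| + 0); last by rewrite addr0.
apply: walk_step => //; apply: walk_nil; apply: edge_point_in_graph => //.
by rewrite uv orbT.
Qed.

Lemma walk_rev p q l : walk e p q l -> walk e q p l.
Proof.
elim=> [{}p Ap|u v s t {}q {}l uv s01 t01 _ IH]; first exact: walk_nil.
rewrite addrC -[`|_|]addr0 distrC; apply: (walk_cat IH).
apply: walk_step => //; apply: walk_nil; apply: edge_point_in_graph => //.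
by rewrite uv orbT.
Qed.

Hypothesis e_connected : connected_graph e.

Lemma walk_vertices u v : exists l, walk e (vp u) (vp v) l.
Proof.
have /connectP[s us ->] := e_connected u v.
elim: s u us => [u _|w s IH u /= /andP[uw /IH[l W]]].
  by exists 0; exact/walk_nil/vertex_in_graph.
exists (`|0 - 1| + l); rewrite -(edge_point0 u w).
by apply: walk_step; rewrite ?lexx ?ler01 // edge_point1.
Qed.

Lemma walk_total p q : A p -> A q -> exists l, walk e p q l.
Proof.
have to_vertex r : A r -> exists u l, walk e r (vp u) l.
  move=> [u [v [t [uv t01 ->]]]]; exists u.
  have [|l W _] := @walk_edge u v t 0 uv t01; first by rewrite lexx ler01.
  by exists l; rewrite -(edge_point0 u v).
move=> /to_vertex[u [l1 W1]] /to_vertex[v [l2 W2]].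
have [l W] := walk_vertices u v.
exists (l1 + (l + l2)); apply: walk_cat W1 _; apply: walk_cat W _.
exact: walk_rev.
Qed.

Local Notation d := (dist e).

Lemma dist_le_walk p q l : walk e p q l -> d p q <= l.
Proof. by move=> W; apply: ge_inf => //; exists 0 => k /walk_ge0. Qed.

(** Connectedness supplies a walk, so the infimum is over a nonempty set; on the empty set [inf]
    would default to 0. *)
Lemma le_dist p q b : A p -> A q -> (forall l, walk e p q l -> b <= l) ->
  b <= d p q.
Proof. by move=> Ap Aq H; apply: lb_le_inf => //; exact: walk_total. Qed.

Lemma dist_ge0 p q : A p -> A q -> 0 <= d p q.
Proof. by move=> Ap Aq; apply: le_dist => // l /walk_ge0. Qed.

Lemma dist_refl p : A p -> d p p = 0.
Proof.
move=> Ap; apply/eqP; rewrite eq_le dist_ge0 // andbT.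
exact/dist_le_walk/walk_nil.
Qed.

Lemma dist_sym p q : d p q = d q p.
Proof. by congr inf; apply/seteqP; split=> l /= /walk_rev. Qed.

Lemma dist_triangle q p r : A p -> A q -> A r -> d p r <= d p q + d q r.
Proof.
move=> Ap Aq Ar; rewrite -lerBlDr; apply: le_dist => // l1 W1.
rewrite lerBlDr -lerBlDl; apply: le_dist => // l2 W2.
by rewrite lerBlDl; apply/dist_le_walk/(walk_cat W1 W2).
Qed.

Lemma dist_edge u v s t : (u == v) || e u v -> 0 <= s <= 1 -> 0 <= t <= 1 ->
  d (edge_point u v s) (edge_point u v t) <= `|s - t|.
Proof.
move=> uv s01 t01; have [l W] := walk_edge uv s01 t01.
exact/le_trans/dist_le_walk.
Qed.

(** * Affine extension of vertex functions and lower bounds on distances *)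

Definition interpolate (f : T -> R) p : R := \sum_w p w * f w.

Lemma interpolate_edge f u v t :
  interpolate f (edge_point u v t) = (1 - t) * f u + t * f v.
Proof.
have delta (a : R) (w0 : T) : \sum_w a * (w == w0)%:R * f w = a * f w0.
  rewrite (bigD1 w0) //= eqxx mulr1 big1 ?addr0 // => w /negPf ->.
  by rewrite mulr0 mul0r.
rewrite -(delta (1 - t) u) -(delta t v) -big_split /=.
by apply: eq_bigr => w _; rewrite ffunE mulrDl.
Qed.

Definition lipschitz_on_edges (f : T -> R) :=
  forall u v, e u v -> `|f u - f v| <= 1.

(** Inside one edge the affine extension of [f] has slope at most 1, so its variation along a walk
    is at most the length of the walk. *)
Lemma interpolate_lipschitz f p q : A p -> A q -> lipschitz_on_edges f ->
  `|interpolate f p - interpolate f q| <= d p q.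
Proof.
move=> Ap Aq fL; apply: le_dist => // l.
elim=> [r _|u v s t r {}l uv s01 t01 _ IH]; first by rewrite subrr normr0.
apply: le_trans (ler_distD (interpolate f (edge_point u v t)) _ _) _.
apply: lerD => //; rewrite !interpolate_edge.
have -> : (1 - s) * f u + s * f v - ((1 - t) * f u + t * f v) =
  (s - t) * (f v - f u) by ring.
by rewrite normrM distrC ler_piMr // -normrN opprB fL.
Qed.

(** A breadth-first search tree with root [r]: [D v] is one more than the
    distance from [r] to [v], and [P v] is the parent of [v]. *)
Definition bfs_tree (r : T) (D : T -> nat) (P : T -> T) : Prop :=
  [/\ D r = 1%N, P r = r,
      forall v, v != r -> e (P v) v /\ D v = (D (P v)).+1,
      forall v, (0 < D v)%N &
      forall u v, e u v -> (D v <= (D u).+1)%N].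

(** A unit-speed climb from [v] towards the root; as the root is its own parent, the path rests
    there afterwards. *)
Definition ray (P : T -> T) v (t : R) : {ffun T -> R} :=
  let k := Num.truncn t in
  edge_point (iter k P v) (iter k.+1 P v) (t - k%:R).

Hypothesis e_sym : symmetric e.

(** * Root paths of a breadth-first tree are geodesics *)

Section Tree.
Variables (r : T) (D : T -> nat) (P : T -> T).
Hypothesis treeP : bfs_tree r D P.

(** At [t = 1] truncation passes to the next edge, but both expressions give the shared vertex. *)
Lemma ray_natD v (k : nat) t : 0 <= t <= 1 ->
  ray P v (k%:R + t) = edge_point (iter k P v) (iter k.+1 P v) t.
Proof.
case/andP=> t0; rewrite le_eqVlt => /orP[/eqP ->|t1].
  by rewrite natr1 /ray natrK subrr edge_point0 edge_point1.
rewrite /ray; have -> : Num.truncn (k%:R + t) = k.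
  by apply: truncn_def; rewrite lerDl t0 -natr1 ltrD2l.
by rewrite [k%:R + t]addrC addrK.
Qed.

Lemma parent_step v : (v == P v) || e v (P v).
Proof.
case: treeP => _ Pr /(_ v) par _ _.
case: (eqVneq v r) par => [->|_ /(_ isT) [evP _]]; first by rewrite Pr eqxx.
by rewrite e_sym evP orbT.
Qed.

Lemma tree_iter v (k : nat) : (k < D v)%N -> D (iter k P v) = (D v - k)%N.
Proof.
case: treeP => Dr Pr par _ _.
elim: k => [|k IH] kv; first by rewrite subn0.
rewrite iterS; have Dk := IH (ltnW kv).
have /par[_] : iter k P v != r.
  by apply: contraTneq kv => Er; move: Dk; rewrite Er Dr; lia.
lia.
Qed.

Lemma tree_iter_root v : iter (D v).-1 P v = r.
Proof.
case: treeP => Dr Pr par Dpos _; apply: contraTeq isT => /par[_].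
by rewrite tree_iter ?ltn_predL ?Dpos //; have := Dpos (P (iter (D v).-1 P v));
  have := Dpos v; lia.
Qed.

(** Labels start at 1 so that the program can keep 0 for unreached vertices; [depth] undoes the
    shift. *)
Definition depth v : R := (D v).-1%:R.

Lemma ray_in_graph v t : 0 <= t -> A (ray P v t).
Proof.
move=> /truncn_itv /andP[t0 t1].
apply: edge_point_in_graph; first exact: parent_step.
by move: t1; rewrite -natr1; lra.
Qed.

(** Two points on one edge are handled by [dist_edge]; the general case cuts at integer times, by
    induction on an integer bound of [t]. *)
Lemma ray_walk v s t : 0 <= s -> s <= t -> d (ray P v s) (ray P v t) <= t - s.
Proof.
move=> s0 st.
have one (k : nat) a b : k%:R <= a -> a <= b -> b <= k.+1%:R ->
    d (ray P v a) (ray P v b) <= b - a.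
  rewrite -natr1 => ka ab bk.
  rewrite -(subrKC k%:R a) -(subrKC k%:R b) !ray_natD; try lra.
  apply: le_trans (dist_edge _ _ _) _; try lra; first exact: parent_step.
  by rewrite distrC ger0_norm; lra.
have [k tk] : exists k : nat, t <= k%:R.
  exists (Num.truncn t).+1; have := truncn_itv (le_trans s0 st); lra.
elim: k t st tk => [|k IH] t st tk.
  have -> : s = t by lra.
  by rewrite dist_refl ?subrr //; apply: ray_in_graph; lra.
have [tk'|kt] := leP t k%:R; first exact: IH.
have [ks|sk] := leP k%:R s; first exact: one st tk.
have Ak : A (ray P v k%:R) by exact: ray_in_graph.
have As : A (ray P v s) by exact: ray_in_graph.
have At : A (ray P v t) by apply: ray_in_graph; lra.
have := dist_triangle As Ak At.
have := IH _ (ltW sk) (lexx _); have := one k _ _ (lexx _) (ltW kt) tk; lra.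
Qed.

Lemma depth_lipschitz : lipschitz_on_edges depth.
Proof.
case: treeP => _ _ _ Dpos DL u v uv.
have := DL u v uv; have := DL v u; rewrite e_sym uv => /(_ isT).
move: (Dpos u) (Dpos v); rewrite /depth.
case: (D u) (D v) => [|a] [|b] //= _ _; rewrite !ltnS => ab ba.
move: ab ba; rewrite -(ler_nat R) -(ler_nat R b) -!natr1 ler_norml; lra.
Qed.

Lemma interpolate_ray v t : 0 <= t <= depth v ->
  interpolate depth (ray P v t) = depth v - t.
Proof.
rewrite /depth; case/andP=> t0 tv; have /andP[kt tk] := truncn_itv t0.
have Dpos : (0 < D v)%N by case: treeP.
rewrite /ray interpolate_edge /depth.
have kv : (Num.truncn t < D v)%N.
  by have := le_trans kt tv; rewrite ler_nat; lia.
rewrite (tree_iter kv).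
case: (ltnP (Num.truncn t).+1 (D v)) => kv'.
  rewrite (tree_iter kv').
  have -> : (D v).-1 =
      ((D v - (Num.truncn t).+1).-1 + 1 + Num.truncn t)%N by lia.
  have -> : (D v - Num.truncn t).-1 =
      ((D v - (Num.truncn t).+1).-1 + 1)%N by lia.
  by rewrite !natrD; ring.
(* Here the next step would pass the root, so [t] equals the depth and the ray is at the root. *)
have kE : (D v).-1 = Num.truncn t by lia.
have -> : t = (Num.truncn t)%:R by apply/eqP; rewrite eq_le kt -{1}kE tv.
rewrite natrK subrr -kE; have -> : (D v - (D v).-1).-1 = 0%N by lia.
by rewrite mul0r subr0 mulr0 addr0 subrr.
Qed.

(** The ray itself gives the upper bound; the lower one holds because the interpolated depth is
    1-Lipschitz and falls at unit speed along the ray. *)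
Lemma ray_isometric v s t : 0 <= s <= depth v -> 0 <= t <= depth v ->
  d (ray P v s) (ray P v t) = `|s - t|.
Proof.
move=> s01 t01.
have [s0 t0] : 0 <= s /\ 0 <= t by lra.
apply/eqP; rewrite eq_le; apply/andP; split.
  have [st|/ltW ts] := leP s t.
    by rewrite distrC ger0_norm ?subr_ge0 // ray_walk.
  by rewrite ger0_norm ?subr_ge0 // dist_sym ray_walk.
have := interpolate_lipschitz (ray_in_graph v s0) (ray_in_graph v t0)
  depth_lipschitz.
rewrite !interpolate_ray //; apply: le_trans; rewrite distrC.
by rewrite (_ : depth v - s - (depth v - t) = t - s) //; ring.
Qed.

Lemma ray0 v : ray P v 0 = vp v.
Proof. by rewrite /ray truncn0 subr0 edge_point0. Qed.

Lemma ray_depth v : ray P v (depth v) = vp r.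
Proof. by rewrite /ray /depth natrK subrr edge_point0 tree_iter_root. Qed.

Lemma dist_root v : d (vp v) (vp r) = depth v.
Proof.
have D0 : 0 <= depth v := ler0n _ _.
rewrite -(ray0 v) -(ray_depth v) ray_isometric ?lexx ?D0 //.
by rewrite sub0r normrN ger0_norm.
Qed.

Lemma ray_geodesic v : geodesic e (vp v) (vp r) (ray P v).
Proof.
rewrite /geodesic dist_root; split; rewrite ?ray0 ?ray_depth //.
  by move=> t /andP[t0 _]; exact: ray_in_graph.
by move=> s t; exact: ray_isometric.
Qed.

End Tree.

(** The labels come from [h v], the least number of edges leading from [r] to [v]; a predecessor on
    a path of that length serves as parent. *)
Lemma bfs_tree_exists r : exists D P, bfs_tree r D P.
Proof.
pose reach := fix reach (k : nat) v : bool :=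
  if k is k'.+1 then [exists w, reach k' w && e w v] else v == r.
have reach_ex v : exists k, reach k v.
  have /connectP[s us ->] := e_connected r v.
  elim/last_ind: s us => [_|s w IH]; first by exists 0%N; rewrite /= eqxx.
  rewrite rcons_path last_rcons => /andP[/IH[k kr] ew].
  exists k.+1; apply/existsP; exists (last r s).
  by apply/andP; split.
pose h v := ex_minn (reach_ex v).
have h_reach v : reach (h v) v by rewrite /h; case: ex_minnP.
have h_min v k : reach k v -> (h v <= k)%N.
  by rewrite /h; case: ex_minnP => m _; apply.
have h_edge u v : e u v -> (h v <= (h u).+1)%N.
  by move=> uv; apply: h_min; apply/existsP; exists u;
    apply/andP; split.
have par v : exists w, if v == r then w = r else e w v /\ h v = (h w).+1.
  case: eqVneq => [_|vr]; first by exists r.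
  have := h_reach v; case hv : (h v) => [|k] /=; first by rewrite (negPf vr).
  case/existsP=> w /andP[kw wv]; exists w; split=> //.
  have := h_edge _ _ wv; have := h_min _ _ kw; lia.
have [P PE] := choice par.
have hr : h r = 0%N by apply/eqP; rewrite -leqn0; apply: h_min; rewrite /= eqxx.
exists (fun v => (h v).+1), P; split=> //.
- by rewrite hr.
- by have := PE r; rewrite eqxx.
- by move=> v vr; have := PE v; rewrite (negPf vr) => -[ev ->].
Qed.

Local Notation dv u v := (d (vp u) (vp v)).

Lemma geodesic_exists x y : exists g, geodesic e (vp x) (vp y) g.
Proof.
have [D [P treeP]] := bfs_tree_exists y.
by exists (ray P x); exact: (ray_geodesic treeP).
Qed.

Lemma geodesic_rev p q g : geodesic e p q g ->
  geodesic e q p (fun t => g (d p q - t)).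
Proof.
case=> g0 gl Ag g_iso; rewrite /geodesic (dist_sym q p); split.
- by rewrite subr0.
- by rewrite subrr.
- by move=> t t01; apply: Ag; lra.
- move=> s t s01 t01; rewrite g_iso; try lra.
  by rewrite distrC; congr `|_|; ring.
Qed.

(** * Consequences of thin triangles *)

Section Thin.
Variable delta : R.
Hypothesis thin : thin_triangles e delta.

(** The Gromov product of [y] and [z] at [x], which is the corner length at [x] of the triangle. *)
Definition gromov x y z : R := (dv x y + dv x z - dv y z) / 2.

Lemma dv_triangle y x z : dv x z <= dv x y + dv y z.
Proof. by apply: dist_triangle; exact: vertex_in_graph. Qed.

Lemma dv_ge0 x y : 0 <= dv x y.
Proof. by apply: dist_ge0; exact: vertex_in_graph. Qed.

Lemma dv_refl x : dv x x = 0.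
Proof. by rewrite dist_refl //; exact: vertex_in_graph. Qed.

Lemma thin_corner x y z g1 g2 t :
  geodesic e (vp x) (vp y) g1 -> geodesic e (vp x) (vp z) g2 ->
  0 <= t <= gromov x y z -> d (g1 t) (g2 t) <= delta.
Proof.
move=> G1 G2 t01; have [g3 G3] := geodesic_exists y z.
have := thin (vertex_in_graph x) (vertex_in_graph y) (vertex_in_graph z)
  G1 G3 G2.
rewrite /insize ge_max => /andP[corner _]; apply: le_trans corner.
have a1 : gromov x y z <= dv x y.
  by rewrite /gromov; have := dv_triangle y x z; lra.
have a2 : gromov x y z <= dv x z.
  by rewrite /gromov; have := dv_triangle z x y; rewrite (dist_sym (vp z)); lra.
have ->: (dv x y + dv y z + dv x z) / 2 - dv y z = gromov x y z.
  by rewrite /gromov; field.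
case: G1 G2 => g10 _ A1 iso1 [g20 _ A2 iso2].
(* [sup] bounds elements only of a bounded set; going through the common corner bounds each distance
   by twice the Gromov product. *)
apply: ub_le_sup; last by exists t.
exists (gromov x y z + gromov x y z) => _ [s /= s01 <-].
have sx : 0 <= s <= dv x y by lra.
have sz : 0 <= s <= dv x z by lra.
apply: le_trans (dist_triangle (A1 s sx) (vertex_in_graph x) (A2 s sz)) _.
rewrite -{1}g10 -{1}g20 iso1 ?iso2 ?lexx ?dv_ge0 //.
by rewrite subr0 sub0r normrN ger0_norm; lra.
Qed.

Lemma delta_ge0 x : 0 <= delta.
Proof.
have [g G] := geodesic_exists x x.
have := @thin_corner x x x g g 0 G G.
case: G => -> _ _ _; rewrite dist_refl; last exact: vertex_in_graph.
by apply; rewrite /gromov dv_refl; lra.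
Qed.

Lemma dist_along_geodesic p q g t : geodesic e p q g -> 0 <= t <= d p q ->
  d (g t) q = d p q - t.
Proof.
move=> [g0 gl Ag iso] /andP[t0 tl]; have l0 := le_trans t0 tl.
rewrite -{1}gl iso ?t0 ?l0 ?lexx //.
by rewrite distrC ger0_norm // subr_ge0.
Qed.

(** The corner lengths at [x] and [y] add up to d(x,y), so [g t] lies in one of the two corners. Its
    partner on [x,v], respectively [y,v], is within [delta] of it and within [t] of [v]. *)
Lemma dist_geodesic_vertex x y v g t :
  geodesic e (vp x) (vp y) g -> 0 <= t <= dv x y ->
  dv x v <= 2 * t -> dv y v <= dv x y -> d (vp v) (g t) <= t + delta.
Proof.
move=> G t01 xv yv; rewrite dist_sym.
have Av := vertex_in_graph v.
have [g1 G1] := geodesic_exists x v.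
have xyv := dv_triangle y x v; have xvy := dv_triangle v x y.
have yxv := dv_triangle x y v.
rewrite (dist_sym (vp v)) in xvy; rewrite (dist_sym (vp y) (vp x)) in yxv.
have Ag : A (g t) by case: (G) => _ _ Ag _; exact: Ag.
have [ta|at_] := leP t (gromov x y v).
  have H : d (g t) (g1 t) <= delta.
    by apply: thin_corner G G1 _; rewrite ta andbT; case/andP: t01.
  have tv : 0 <= t <= dv x v by move: ta; rewrite /gromov; lra.
  have A1 : A (g1 t) by case: (G1) => _ _ A1 _; exact: A1.
  have := dist_triangle Ag A1 Av; rewrite (dist_along_geodesic G1 tv); lra.
have [g2 G2] := geodesic_exists y v.
set s := dv x y - t.
have st : t = dv x y - s by rewrite /s; ring.
have s01 : 0 <= s <= gromov y x v.
  by move: at_; rewrite /gromov /s (dist_sym (vp y) (vp x)); lra.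
have H := thin_corner (geodesic_rev G) G2 s01; rewrite -st in H.
have sv : 0 <= s <= dv y v.
  by move: s01; rewrite /gromov (dist_sym (vp y) (vp x)); lra.
have A2 : A (g2 s) by case: (G2) => _ _ A2 _; exact: A2.
by have := dist_triangle Ag A2 Av; rewrite (dist_along_geodesic G2 sv); lra.
Qed.

(** At distance [m] from [z], the geodesics to [u] and [v] are both within [delta] of the one to
    [x], so d(u,v) is at most d(z,u) + d(z,v) - 2m + 2 delta. Put in the value of [m] and use that
    [x] is furthest from [z]. *)
Lemma dist_le_furthest z x : (forall v, dv z v <= dv z x) ->
  forall u v, dv u v <= Num.max (dv u x) (dv v x) + 2 * delta.
Proof.
move=> far u v; pose m := Num.min (gromov z u x) (gromov z v x).
have m0 : 0 <= m.
  rewrite /m /gromov le_min.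
  have := dv_triangle z u x; have := dv_triangle z v x.
  by rewrite (dist_sym (vp u) (vp z)) (dist_sym (vp v) (vp z)); lra.
have [mu mv] : m <= gromov z u x /\ m <= gromov z v x.
  by rewrite /m; split; rewrite ge_min lexx ?orbT.
have [gu Gu] := geodesic_exists z u.
have [gv Gv] := geodesic_exists z v.
have [gx Gx] := geodesic_exists z x.
have Hu : d (gu m) (gx m) <= delta by apply: thin_corner Gu Gx _; lra.
have Hv : d (gv m) (gx m) <= delta by apply: thin_corner Gv Gx _; lra.
have := dv_triangle x z u; have := dv_triangle x z v.
have := dv_triangle u z x; have := dv_triangle v z x.
rewrite (dist_sym (vp x) (vp u)) (dist_sym (vp x) (vp v)) => T1 T2 T3 T4.
have mzu : 0 <= m <= dv z u by move: mu; rewrite /gromov; lra.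
have mzv : 0 <= m <= dv z v by move: mv; rewrite /gromov; lra.
have mzx : 0 <= m <= dv z x by move: mv; rewrite /gromov; lra.
have Au : A (gu m) by case: (Gu) => _ _ Au _; exact: Au.
have Av : A (gv m) by case: (Gv) => _ _ Av _; exact: Av.
have Ax : A (gx m) by case: (Gx) => _ _ Ax _; exact: Ax.
have Vu := vertex_in_graph u; have Vv := vertex_in_graph v.
have := dist_along_geodesic Gu mzu; have := dist_along_geodesic Gv mzv.
have := dist_triangle Vu Au Vv; have := dist_triangle Au Av Vv.
have := dist_triangle Au Ax Av.
rewrite (dist_sym (gx m)) (dist_sym (vp u) (gu m)).
have uz : dv z u <= dv z x by []; have vz : dv z v <= dv z x by [].
have [xu xv] : dv u x <= Num.max (dv u x) (dv v x) /\
    dv v x <= Num.max (dv u x) (dv v x).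
  by split; rewrite le_max lexx ?orbT.
move: xu xv; set M := Num.max _ _ => xu xv.
have [mE|mE] : m = gromov z u x \/ m = gromov z v x.
  by rewrite /m; case: leP => _; [left|right].
all: by rewrite /gromov in mE; lra.
Qed.

End Thin.

(** * A lower bound on the 2-radius *)

Lemma radius2_lower_bound x y v r2 : is_radius e 2 r2 ->
  dv x v <= dv x y -> dv x v <= 2 * r2 \/ dv y v <= 2 * r2.
Proof.
move=> [[C [CA C2 Cdom]] _] xv.
have cover u w c : C c -> d (vp u) c <= r2 -> d (vp w) c <= r2 ->
    dv u w <= 2 * r2.
  move=> /CA Ac uc wc.
  have := dist_triangle (vertex_in_graph u) Ac (vertex_in_graph w).
  by rewrite (dist_sym c); lra.
have [[cx Cx xc] [cy Cy yc] [cv Cv vc]] := And3 (Cdom x) (Cdom y) (Cdom v).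
(* Pigeonhole: three vertices are served by at most two centers. If [x] and [y] share one, d(x,v) <=
   d(x,y) concludes. *)
have : cx = cy \/ cx = cv \/ cy = cv.
  have /pcard_leP[f] := C2.
  have f2 c : C c -> (f c < 2)%N by exact: 'funS_f.
  have finj c c' : C c -> C c' -> f c = f c' -> c = c'.
    have fI : {in C &, injective f} := 'inj_f.
    by move=> Cc Cc'; apply: fI; rewrite inE.
  have := f2 _ Cx; have := f2 _ Cy; have := f2 _ Cv => H1 H2 H3.
  have : f cx = f cy \/ f cx = f cv \/ f cy = f cv by lia.
  by case=> [|[]] /finj; auto.
case=> [E|[E|E]].
- left; apply: le_trans xv _; apply: cover Cx xc _; by rewrite E.
- by left; apply: cover Cx xc _; rewrite E.
- by right; apply: cover Cy yc _; rewrite E.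
Qed.

End Metric.

(** * Integer distances between vertices *)

Section Hop.
Variables (R : realType) (T : finType) (e : rel T).
Hypotheses (e_sym : symmetric e) (e_connected : connected_graph e).
Implicit Types (u v w x y z : T).
Local Notation vp := (vertex_point R).

(** Distances between vertices are integers, so the truncation loses nothing ([hopE]) and makes them
    comparable with the labels. *)
Definition hop u v : nat := Num.truncn (dist e (vp u) (vp v)).

Lemma bfs_tree_hop r D P v : bfs_tree e r D P -> D v = (hop r v).+1.
Proof.
move=> tree; rewrite /hop dist_sym (dist_root R e_connected e_sym tree) /depth.
by rewrite natrK prednK //; case: tree.
Qed.

Lemma hopE u v : dist e (vp u) (vp v) = (hop u v)%:R.
Proof.
have [D [P tree]] := bfs_tree_exists e_connected v.
by rewrite /hop (dist_root R e_connected e_sym tree) natrK.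
Qed.

Lemma hop_sym u v : hop u v = hop v u.
Proof. by rewrite /hop dist_sym. Qed.

Variable delta : R.
Hypothesis thin : thin_triangles e delta.

Lemma hop_le_furthest z x : (forall v, (hop z v <= hop z x)%N) ->
  forall u v, (hop u v <= maxn (hop x u) (hop x v) + Num.truncn (2 * delta))%N.
Proof.
move=> far u v; have d0 := delta_ge0 e_connected e_sym thin x.
have [le|le] := leqP (hop u v) (maxn (hop x u) (hop x v)).
  exact: leq_trans le (leq_addr _ _).
rewrite -leq_subLR truncn_ge_nat; last lra.
rewrite natrB ?(ltnW le) // lerBlDl natr_max -!hopE.
rewrite (dist_sym _ (vp x) (vp u)) (dist_sym _ (vp x) (vp v)).
by apply: dist_le_furthest => // w; rewrite !hopE ler_nat.
Qed.

(** The point is at distance (2k + a)/2 from [x]: [k] whole edges, then half an edge when the sum is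
    odd. *)
Lemma center_dominates x y D P k (a : nat) v : bfs_tree e y D P ->
  (a <= 1)%N -> (k.*2 + a <= hop x y)%N -> (hop x v <= k.*2 + a)%N ->
  (hop y v <= hop y x)%N ->
  dist e (vp v) (edge_point (iter k P x) (iter k.+1 P x) (a%:R / 2)) <=
    (k.*2 + a)%:R / 2 + delta.
Proof.
move=> tree a1 kxy xv yv.
pose h : R := a%:R / 2; have a01 : 0 <= h <= 1.
  apply/andP; split; first by rewrite divr_ge0.
  rewrite ler_pdivrMr // mul1r ler_nat.
  exact: leq_trans a1 _.
rewrite -(@ray_natD _ _ P x k _ a01).
have kaE : k%:R + h = (k.*2 + a)%:R / 2 :> R.
  by rewrite /h natrD -muln2 natrM; field.
rewrite kaE; apply: (dist_geodesic_vertex e_connected e_sym thin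
  (ray_geodesic R e_connected e_sym tree x)).
- rewrite hopE; move: kxy; rewrite -(ler_nat R).
  by have := ler0n R (k.*2 + a); lra.
- by rewrite hopE [2 * _]mulrC divfK ?ler_nat // pnatr_eq0.
- by rewrite !hopE ler_nat (hop_sym x).
Qed.

Lemma hop_radius2 x y v (r2 : R) : is_radius e 2 r2 -> (hop x v <= hop x y)%N ->
  (minn (hop x v) (hop y v))%:R / 2 <= r2.
Proof.
move=> rad xv; rewrite natr_min -!hopE ler_pdivrMr ?ltr0n // mulrC ge_min.
apply/orP.
by apply: radius2_lower_bound => //; rewrite !hopE ler_nat.
Qed.

End Hop.

(** * The degree sum *)

Lemma sum_degrees n (e : rel 'I_n) (adj : 'I_n -> seq 'I_n) :
  simple_graph e -> adjacency_lists e adj ->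
  (\sum_v size (adj v) <= 2 * num_edges e)%N.
Proof.
move=> [e_sym e_irr] adjP; rewrite /num_edges.
pose A := [set p : 'I_n * 'I_n | e p.1 p.2]%SET.
have -> : (\sum_v size (adj v) = #|A|)%N.
  rewrite -sum1_card; under eq_bigr do rewrite -sum1_size.
  under eq_bigr => v _ do rewrite (big_uniq _ (proj1 (adjP v))).
  rewrite pair_big_dep /=; apply: eq_bigl => -[v w] /=.
  by rewrite inE /= (proj2 (adjP v)).
(* An ordered edge is recovered from its unordered pair and one orientation bit. *)
pose f (p : 'I_n * 'I_n) := ([set p.1; p.2]%SET, (p.1 < p.2)%N).
have f_inj : {in A &, injective f}.
  move=> [a b] [c d]; rewrite !inE /= => ab cd [/setP E lt].
  have ne x y : e x y -> x != y by apply: contraTneq => ->; rewrite e_irr.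
  have := E a; have := E b; have := E c; have := E d.
  rewrite !inE !eqxx /= ?orbT => Ed Ec Eb Ea.
  move: (ne _ _ ab) (ne _ _ cd) lt Ea Eb Ec Ed; rewrite -!val_eqE /= => *.
  by congr pair; apply/val_inj => /=; lia.
rewrite -(card_in_imset f_inj); set E := [set _ | _ : _ & _]%SET.
rewrite -card_bool mulnC -(cardsT bool) -cardsX.
apply: subset_leq_card; apply/fintype.subsetP => _ /imsetP[p pA ->].
rewrite /f !inE andbT; by apply/imsetP; exists p.
Qed.

Local Open Scope nat_scope.

(** * Total correctness with running time *)

Fixpoint regs_written (c : cmd) : seq nat :=
  match c with
  | Const x _ | Move x _ | Succ x _ | Pred x _ | ReadCell x _ _ => [:: x]
  | Seq c1 c2 | IfLt _ _ c1 c2 => regs_written c1 ++ regs_written c2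
  | WhileLt _ _ c => regs_written c
  | Skip | WriteCell _ _ _ => [::]
  end.

Fixpoint arrs_written (c : cmd) : seq nat :=
  match c with
  | WriteCell a _ _ => [:: a]
  | Seq c1 c2 | IfLt _ _ c1 c2 => arrs_written c1 ++ arrs_written c2
  | WhileLt _ _ c => arrs_written c
  | _ => [::]
  end.

(** A frame condition read off the syntax: it carries facts about untouched registers and arrays
    across subprograms. *)
Definition framed (c : cmd) (s s' : state) : Prop :=
  (forall x, x \notin regs_written c -> reg s' x = reg s x) /\
  (forall a i, a \notin arrs_written c -> arr s' a i = arr s a i).

Lemma framed_trans c s1 s2 s3 : framed c s1 s2 -> framed c s2 s3 ->
  framed c s1 s3.
Proof.
move=> [r1 a1] [r2 a2]; split=> [x xc|a i ac].
  by rewrite r2 // r1.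
by rewrite a2 // a1.
Qed.

Lemma exec_framed c s t s' : exec c s t s' -> framed c s s'.
Proof.
elim=> {c s t s'}; try by move=> *; split=> //= z; rewrite inE => /negPf ->.
- by move=> a x y s; split=> //= b i; rewrite inE => /negPf ->.
- move=> c1 c2 s1 s2 s3 t1 t2 _ [r1 a1] _ [r2 a2]; split=> [x|a i] /=;
    rewrite mem_cat => /norP[n1 n2]; by [rewrite r2 // r1 | rewrite a2 // a1].
- move=> x y c1 c2 s s' t _ _ [r1 a1]; split=> [z|a i] /=;
    rewrite mem_cat => /norP[n1 n2]; by [rewrite r1 | rewrite a1].
- move=> x y c1 c2 s s' t _ _ [r1 a1]; split=> [z|a i] /=;
    rewrite mem_cat => /norP[n1 n2]; by [rewrite r1 | rewrite a1].
- by move=> x y c s1 s2 s3 t1 t2 _ _ F1 _ F2; exact: framed_trans F1 F2.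
Qed.

(** A weakest precondition for total correctness, with the running time passed to the
    postcondition. *)
Definition runs (c : cmd) (s : state) (Q : nat -> state -> Prop) : Prop :=
  exists t s', exec c s t s' /\ Q t s'.

Lemma runs_conseq c s (Q Q' : nat -> state -> Prop) : runs c s Q ->
  (forall t s', framed c s s' -> Q t s' -> Q' t s') -> runs c s Q'.
Proof.
move=> [t [s' [E q]]] QQ'; exists t, s'; split=> //; apply: QQ' q.
exact: exec_framed E.
Qed.

Lemma runs_skip s (Q : nat -> state -> Prop) : Q 1 s -> runs Skip s Q.
Proof. by move=> q; exists 1, s; split=> //; constructor. Qed.

Lemma runs_const x k s (Q : nat -> state -> Prop) :
  Q 1 (set_reg s x k) -> runs (Const x k) s Q.
Proof. by move=> q; exists 1, (set_reg s x k); split=> //; constructor. Qed.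

Lemma runs_move x y s (Q : nat -> state -> Prop) :
  Q 1 (set_reg s x (reg s y)) -> runs (Move x y) s Q.
Proof. by move=> q; eexists; eexists; split; [constructor|exact: q]. Qed.

Lemma runs_succ x y s (Q : nat -> state -> Prop) :
  Q 1 (set_reg s x (reg s y).+1) -> runs (Succ x y) s Q.
Proof. by move=> q; eexists; eexists; split; [constructor|exact: q]. Qed.

Lemma runs_read x a y s (Q : nat -> state -> Prop) :
  Q 1 (set_reg s x (arr s a (reg s y))) -> runs (ReadCell x a y) s Q.
Proof. by move=> q; eexists; eexists; split; [constructor|exact: q]. Qed.

Lemma runs_write a x y s (Q : nat -> state -> Prop) :
  Q 1 (set_arr s a (reg s x) (reg s y)) -> runs (WriteCell a x y) s Q.
Proof. by move=> q; eexists; eexists; split; [constructor|exact: q]. Qed.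

Lemma runs_seq c1 c2 s (Q : nat -> state -> Prop) :
  runs c1 s (fun t1 s1 => runs c2 s1 (fun t2 => Q (t1 + t2))) ->
  runs (Seq c1 c2) s Q.
Proof.
move=> [t1 [s1 [E1 [t2 [s2 [E2 q]]]]]].
by exists (t1 + t2), s2; split=> //; exact: exec_seq E1 E2.
Qed.

Lemma runs_if x y c1 c2 s (Q : nat -> state -> Prop) :
  (reg s x < reg s y -> runs c1 s (fun t => Q t.+1)) ->
  (reg s y <= reg s x -> runs c2 s (fun t => Q t.+1)) ->
  runs (IfLt x y c1 c2) s Q.
Proof.
move=> q1 q2; case: (ltnP (reg s x) (reg s y)) => H.
  have [t [s' [E q]]] := q1 H; exists t.+1, s'; split=> //.
  exact: exec_if_true.
have [t [s' [E q]]] := q2 H; exists t.+1, s'; split=> //.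
exact: exec_if_false.
Qed.

(** [I k s] is a loop invariant carrying a potential [k], which pays for the
    remaining iterations and thus gives both termination and the time bound. *)
Lemma runs_while x y c (I : nat -> state -> Prop) s0 k0 : I k0 s0 ->
  (forall k s, framed c s0 s -> I k s -> reg s x < reg s y ->
     runs c s (fun t s' => exists2 k', I k' s' & t + k' < k)) ->
  runs (WhileLt x y c) s0 (fun t s' =>
    exists k, [/\ I k s', reg s' y <= reg s' x & t + k <= k0.+1]).
Proof.
move=> I0 body.
(* Induction on a bound [m] of the potential; the strict decrease in [body] pays for the loop
   test. *)
suff H m k s : k <= m -> framed c s0 s -> I k s ->
    runs (WhileLt x y c) s (fun t s' =>
      exists k', [/\ I k' s', reg s' y <= reg s' x & t + k' <= k.+1]).
  exact: (H k0 k0 s0).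
elim: m k s => [|m IH] k s km F Ik.
  case: (ltnP (reg s x) (reg s y)) => [lt|le].
    by have [t [s' [_ [k' _]]]] := body k s F Ik lt; lia.
  by exists 1, s; split; [exact: exec_while_false|exists k].
case: (ltnP (reg s x) (reg s y)) => [lt|le]; last first.
  by exists 1, s; split; [exact: exec_while_false|exists k].
have [t1 [s1 [E1 [k1 I1 lt1]]]] := body k s F Ik lt.
have [|| t2 [s2 [E2 [k2 [I2 le2 t2k]]]]] := IH k1 s1 _ _ I1.
- lia.
- exact: framed_trans F (exec_framed E1).
exists (t1 + t2).+1, s2; split; first exact: exec_while_true lt E1 E2.
by exists k2; split=> //; lia.
Qed.

Local Notation "c1 ;; c2" := (Seq c1 c2) (at level 60, right associativity).

Ltac step := first
  [ apply: runs_const | apply: runs_move | apply: runs_succ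
  | apply: runs_read | apply: runs_write | apply: runs_skip
  | apply: runs_seq ]; rewrite /=.

(** * The invariant of breadth-first search on an abstract queue *)

Section BFS.
Variables (n : nat) (e : rel 'I_n) (adj : 'I_n -> seq 'I_n).
Hypothesis e_connected : connected_graph e.
Hypothesis adjP : adjacency_lists e adj.
Implicit Types (u v w : 'I_n) (s : state) (D : 'I_n -> nat)
  (P : 'I_n -> 'I_n) (dn rs todo : seq 'I_n).

Definition upd (X : Type) (f : 'I_n -> X) w (a : X) v : X :=
  if v == w then a else f v.

(** The queue of a breadth-first search from [src] is [dn ++ rs], of which
    [dn] has been dequeued; the neighbours of [u] in [todo] are still to be
    scanned. [D v] is one more than the tentative distance of [v], and [0] if
    [v] has not been reached. *)
Record bfs_inv src u todo dn rs D P : Prop := BfsInv {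
  inv_uniq : uniq (dn ++ rs);
  inv_mem : forall v, (v \in dn ++ rs) = (0 < D v);
  inv_sorted : pairwise (fun v w => D v <= D w) (dn ++ rs);
  inv_near : forall v w, v \in dn ++ rs -> w \in rs -> D v <= (D w).+1;
  inv_scan : forall v w, v \in dn -> e v w ->
    (v == u) && (w \in todo) || (0 < D w <= (D v).+1);
  inv_root : D src = 1 /\ P src = src;
  inv_parent : forall v, v \in dn ++ rs -> v != src ->
    [/\ e (P v) v, D v = (D (P v)).+1 & 0 < D (P v)];
  inv_bound : forall v, D v <= size (dn ++ rs) }.

(** With these bounds, appending a vertex labelled [(D u).+1] keeps the queue sorted and its waiting
    labels within one of each other. *)
Definition scanning u dn rs D : Prop :=
  [/\ u \in dn, forall v, v \in dn ++ rs -> D v <= (D u).+1 &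
      forall w, w \in rs -> D u <= D w].

Lemma bfs_inv_init src : bfs_inv src src [::] [::] [:: src]
  (fun v => (v == src) : nat) (fun=> src).
Proof.
split=> //=.
- by move=> v; rewrite inE; case: (v == src).
- by move=> v w _; rewrite inE => /eqP ->; rewrite eqxx; case: (v == src).
- by rewrite eqxx.
- by move=> v; rewrite inE => /eqP ->; rewrite eqxx.
- by move=> v; case: (v == src).
Qed.

Lemma bfs_inv_pop src u0 u dn rs D P :
  bfs_inv src u0 [::] dn (u :: rs) D P ->
  bfs_inv src u (adj u) (rcons dn u) rs D P /\ scanning u (rcons dn u) rs D.
Proof.
case=> q_uniq q_mem q_sorted q_near q_scan q_root q_par q_bound.
split; last first.
  rewrite /scanning cat_rcons mem_rcons mem_head; split=> //.
    by move=> v vq; apply: q_near => //; rewrite mem_head.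
  move=> w wrs; move: q_sorted; rewrite pairwise_cat /= => /and3P[_ _].
  by case/andP=> /allP/(_ w wrs).
split=> //; rewrite ?cat_rcons //.
- by move=> v w vq wrs; apply: q_near => //; rewrite inE wrs orbT.
- move=> v w; rewrite mem_rcons inE; case: eqVneq => [->|_] /= vdn vw.
    by have [_ ->] := adjP u; rewrite vw.
  by have := q_scan _ _ vdn vw; rewrite in_nil andbF.
Qed.

(** A vertex labelled earlier has a label at most [(D u).+1], so the edge to it already satisfies
    [inv_scan]. *)
Lemma bfs_inv_skip src u w todo dn rs D P :
  bfs_inv src u (w :: todo) dn rs D P -> scanning u dn rs D -> 0 < D w ->
  bfs_inv src u todo dn rs D P.
Proof.
case=> q_uniq q_mem q_sorted q_near q_scan q_root q_par q_bound [_ cur _] Dw.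
split=> // v z vdn vz; have := q_scan _ _ vdn vz; rewrite inE.
case: eqVneq => //= ->; case: eqVneq => //= -> _.
by rewrite Dw cur ?orbT // q_mem.
Qed.

(** The new vertex was outside the queue, so no queued label or parent changes, and its label is the
    largest. *)
Lemma bfs_inv_push src u w todo dn rs D P :
  bfs_inv src u (w :: todo) dn rs D P -> scanning u dn rs D -> D w = 0 ->
  e u w ->
  bfs_inv src u todo dn (rcons rs w) (upd D w (D u).+1) (upd P w u) /\
  scanning u dn (rcons rs w) (upd D w (D u).+1).
Proof.
case=> q_uniq q_mem q_sorted q_near q_scan [Dsrc Psrc] q_par q_bound.
move=> [udn cur_le cur_ge] Dw uw.
have wq : w \notin dn ++ rs by rewrite q_mem Dw.
have Dold v : v \in dn ++ rs -> upd D w (D u).+1 v = D v.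
  by rewrite /upd; case: eqVneq => // ->; rewrite (negPf wq).
have rs_q v : v \in rs -> v \in dn ++ rs by rewrite mem_cat orbC => ->.
have dn_q v : v \in dn -> v \in dn ++ rs by rewrite mem_cat => ->.
have Dnew : upd D w (D u).+1 w = (D u).+1 by rewrite /upd eqxx.
have Du := Dold _ (dn_q _ udn).
have memE v : (v \in dn ++ rcons rs w) = (v == w) || (v \in dn ++ rs).
  by rewrite -rcons_cat mem_rcons inE.
split; last first.
  split=> // v; rewrite Du.
    by rewrite memE => /orP[/eqP ->|vq]; rewrite ?Dnew // Dold // cur_le.
  rewrite mem_rcons inE => /orP[/eqP ->|vrs]; rewrite ?Dnew //.
  by rewrite Dold ?cur_ge ?rs_q.
split.
- by rewrite -rcons_cat rcons_uniq wq.
- by move=> v; rewrite memE /upd; case: eqVneq => //=.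
- rewrite -rcons_cat pairwise_rcons; apply/andP; split.
    by apply/allP => v vq; rewrite /= Dnew Dold // cur_le.
  have eqD : {in dn ++ rs &, (fun v z => upd D w (D u).+1 v <=
      upd D w (D u).+1 z) =2 (fun v z => D v <= D z)}.
    by move=> v z vq zq; rewrite /= !Dold.
  by rewrite (eq_in_pairwise eqD) //; exact/allP.
- move=> v z; rewrite memE mem_rcons inE.
  move=> vq' /orP[/eqP ->|zrs]; last rewrite (Dold z) ?rs_q //.
    by rewrite Dnew; case/orP: vq' => [/eqP ->|vq]; rewrite ?Dnew // Dold //
      ltnW // ltnS cur_le.
  case/orP: vq' => [/eqP ->|vq]; first by rewrite Dnew ltnS cur_ge.
  by rewrite Dold // q_near.
- move=> v z vdn vz; rewrite (Dold v) ?dn_q //.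
  have := q_scan _ _ vdn vz; rewrite inE /upd.
  case: (eqVneq z w) => [->|_] //=.
  by case: eqVneq => [->|_] /=; rewrite ?leqnn ?orbT // Dw.
- have sw : src != w by apply: contra_eq_neq Dsrc => ->; rewrite Dw.
  by rewrite /upd (negPf sw).
- move=> v; rewrite memE /upd; case: eqVneq => [->|vw] /= vq vs.
    have uw' : u != w by apply: contraNneq wq => <-; exact: dn_q.
    by rewrite (negPf uw') -q_mem dn_q.
  have [ePv DPv D0] := q_par v vq vs; split=> //.
    have Pw : P v != w by apply: contraTneq D0 => ->; rewrite Dw.
    by rewrite (negPf Pw).
  by case: ifP.
- move=> v; rewrite -rcons_cat size_rcons /upd; case: ifP => _.
    by rewrite ltnS q_bound.
  by rewrite ltnW // ltnS q_bound.
Qed.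

(** The dequeued vertices are closed under edges, hence are all the vertices; sortedness makes the
    last one furthest, and the absence of repetitions bounds labels by [n]. *)
Lemma bfs_inv_final src u dn D P : bfs_inv src u [::] dn [::] D P ->
  [/\ bfs_tree e src D P, forall v, D v <= D (last src dn),
      forall v, D v <= n & dn <> [::]].
Proof.
case; rewrite cats0 => q_uniq q_mem q_sorted _ q_scan [Dsrc Psrc] q_par q_bound.
have scan v w : v \in dn -> e v w -> 0 < D w <= (D v).+1.
  by move=> vdn vw; have := q_scan _ _ vdn vw; rewrite in_nil andbF.
have all_dn v : v \in dn.
  have /connectP[p ep ->] := e_connected src v.
  have : src \in dn by rewrite q_mem Dsrc.
  elim: p src ep {Dsrc Psrc q_par} => [|w p IH] x //= /andP[xw wp] xdn.
  by apply: IH wp _; rewrite q_mem; case/andP: (scan _ _ xdn xw).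
split.
- split=> //.
  + by move=> v vs; have [? ? _] := q_par v (all_dn v) vs.
  + by move=> v; rewrite -q_mem.
  + by move=> v w /(scan _ _ (all_dn v))/andP[].
- move=> v; have := all_dn v; case/lastP: dn q_sorted {q_uniq q_mem q_scan q_par
    q_bound scan all_dn} => [|dn w] // + vdn.
  rewrite pairwise_rcons last_rcons => /andP[/allP H _].
  by move: vdn; rewrite mem_rcons inE => /orP[/eqP ->|/H].
- move=> v; apply: leq_trans (q_bound v) _.
  by rewrite -(card_uniqP q_uniq) -[leqRHS]card_ord max_card.
- by move=> dn0; have := all_dn src; rewrite dn0.
Qed.

End BFS.

(** * The breadth-first search program *)

(** Registers of the breadth-first search: 9 clearing index, 10 and 11 the
    constants 0 and 1, 12 and 13 head and tail of the queue (array 2), 14 the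
    dequeued vertex, 15 the label of its children, 16 and 17 bounds of its
    adjacency list, 18 the scanned neighbour, 19 its label, 20 the root. Labels
    and parents are stored in the arrays [aD] and [aP]. *)
Definition relax (aD aP : nat) : cmd :=
  ReadCell 18 1 16 ;; Succ 16 16 ;; ReadCell 19 aD 18 ;;
  IfLt 19 11
    (WriteCell aD 18 15 ;; WriteCell aP 18 14 ;; WriteCell 2 13 18 ;;
     Succ 13 13)
    Skip.

Definition scan (aD aP : nat) : cmd :=
  ReadCell 14 2 12 ;; Succ 12 12 ;; ReadCell 15 aD 14 ;; Succ 15 15 ;;
  ReadCell 16 0 14 ;; Succ 17 14 ;; ReadCell 17 0 17 ;;
  WhileLt 16 17 (relax aD aP).

(** Labels are cleared first because sweeps reuse the same arrays. Register 14 ends with the last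
    dequeued vertex, which is furthest from the root; the final read fetches its label. *)
Definition bfs (aD aP : nat) : cmd :=
  Const 9 0 ;; Const 10 0 ;;
  WhileLt 9 0 (WriteCell aD 9 10 ;; Succ 9 9) ;;
  Const 11 1 ;; WriteCell aD 20 11 ;; WriteCell aP 20 20 ;;
  WriteCell 2 10 20 ;; Const 12 0 ;; Const 13 1 ;;
  WhileLt 12 13 (scan aD aP) ;;
  ReadCell 15 aD 14.

Section BFSProgram.
Variables (n : nat) (e : rel 'I_n) (adj : 'I_n -> seq 'I_n).
Hypothesis e_connected : connected_graph e.
Hypothesis adjP : adjacency_lists e adj.
Variables (aD aP : nat).
Hypothesis aDP : uniq [:: 0; 1; 2; aD; aP].
Implicit Types (u v w : 'I_n) (s : state) (D : 'I_n -> nat)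
  (P : 'I_n -> 'I_n) (dn rs todo : seq 'I_n).

Definition graph_input s : Prop :=
  reg s 0 = n /\ forall v,
    arr s 0 v.+1 = arr s 0 v + size (adj v) /\
    forall k, k < size (adj v) -> arr s 1 (arr s 0 v + k) = nth v (adj v) k.

Lemma graph_input_framed c s s' : framed c s s' ->
  0 \notin regs_written c -> 0 \notin arrs_written c ->
  1 \notin arrs_written c -> graph_input s -> graph_input s'.
Proof.
move=> [Fr Fa] r0 a0 a1 [n0 H]; split=> [|v]; first by rewrite Fr.
by have [H0 H1] := H v; rewrite !Fa //; split=> // k kv; rewrite Fa // H1.
Qed.

(** Parents are specified for reached vertices only, as other cells may be left from an earlier
    search. *)
Definition represents s (q : seq 'I_n) D P : Prop :=
  [/\ forall v, arr s aD v = D v,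
      forall v, 0 < D v -> arr s aP v = P v,
      reg s 13 = size q &
      forall i, i < size q -> arr s 2 i = nth 0 [seq val v | v <- q] i].

Lemma array_neqs : ((aD == 0) = false) * ((aD == 1) = false) *
  ((aD == 2) = false) * ((aP == 0) = false) * ((aP == 1) = false) *
  ((aP == 2) = false) * ((0 == aD) = false) * ((1 == aD) = false) *
  ((2 == aD) = false) * ((0 == aP) = false) * ((1 == aP) = false) *
  ((2 == aP) = false) * ((aD == aP) = false) * ((aP == aD) = false).
Proof. by move: aDP; rewrite /= !inE !negb_or; do !split; lia. Qed.

Lemma relax_spec src s u w todo dn rs D P :
  graph_input s -> reg s 11 = 1 -> reg s 14 = u -> reg s 15 = (D u).+1 ->
  arr s 1 (reg s 16) = w -> e u w ->
  represents s (dn ++ rs) D P ->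
  bfs_inv e src u (w :: todo) dn rs D P -> scanning u dn rs D ->
  runs (relax aD aP) s (fun t s' => exists rs' D' P',
    [/\ represents s' (dn ++ rs') D' P', bfs_inv e src u todo dn rs' D' P',
        scanning u dn rs' D', D' u = D u &
        reg s' 16 = (reg s 16).+1 /\ t <= 8]).
Proof.
move=> Gs r11 r14 r15 a1 uw [sD sP s13 s2] inv sc.
rewrite /relax; do 3 (step; step).
rewrite a1 sD; apply: runs_if => /=; rewrite r11 => Dw.
  have Dw0 : D w = 0 by lia.
  have [inv' sc'] := bfs_inv_push inv sc Dw0 uw.
  do 3 (step; step); step.
  exists (rcons rs w), (upd D w (D u).+1), (upd P w u); split=> //.
  - split=> /=.
    + by move=> v; rewrite !array_neqs eqxx /= sD /upd r15.
    + move=> v; rewrite !array_neqs eqxx /= /upd -val_eqE /=.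
      by case: ifP => // _; exact: sP.
    + by rewrite s13 -rcons_cat size_rcons.
    + move=> i; rewrite -rcons_cat size_rcons map_rcons nth_rcons size_map.
      rewrite !array_neqs /= s13.
      rewrite ltnS leq_eqVlt; case: eqVneq => [-> _|_ /= iq].
        by rewrite ltnn.
      by rewrite iq s2.
  - case: sc => udn _ _; rewrite /upd; case: eqVneq => // uw'.
    by case: inv => _ q_mem; have := q_mem u; rewrite mem_cat udn uw' Dw0.
step; exists rs, D, P; split=> //.
by apply: bfs_inv_skip inv sc _; lia.
Qed.

Lemma scan_spec src s u u0 dn rs D P :
  graph_input s -> reg s 11 = 1 -> reg s 12 = size dn ->
  represents s (dn ++ u :: rs) D P ->
  bfs_inv e src u0 [::] dn (u :: rs) D P ->
  runs (scan aD aP) s (fun t s' => exists rs' D' P',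
    [/\ represents s' (rcons dn u ++ rs') D' P',
        bfs_inv e src u [::] (rcons dn u) rs' D' P',
        reg s' 12 = (size dn).+1, reg s' 14 = u &
        t <= 8 + 9 * size (adj u)]).
Proof.
move=> Gs r11 r12 reps inv; have [sD sP s13 s2] := reps.
have [inv1 sc1] := bfs_inv_pop adjP inv.
have qu : arr s 2 (size dn) = u.
  rewrite s2 ?size_cat /= ?addnS ?ltnS ?leq_addr //.
  by rewrite map_cat nth_cat size_map ltnn subnn.
rewrite /scan; do 7 (step; step).
rewrite r12 qu sD; have [n0 /(_ u) [off_end nbr]] := Gs; rewrite off_end.
set s1 := set_reg _ _ _.
(* Nine units per remaining neighbour: eight for [relax] and one for the test. *)
pose I k s' := exists done todo rs' D' P',
  [/\ adj u = done ++ todo, reg s' 16 = arr s 0 u + size done,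
      represents s' (rcons dn u ++ rs') D' P' /\ D' u = D u,
      bfs_inv e src u todo (rcons dn u) rs' D' P' /\
      scanning u (rcons dn u) rs' D' & k = 9 * size todo].
apply: runs_conseq
  (@runs_while 16 17 (relax aD aP) I s1 (9 * size (adj u)) _ _) _.
- exists [::], (adj u), rs, D, P; split=> //=; first by rewrite addn0.
  split=> //; split=> //=; rewrite cat_rcons //.
- move=> k s' [Fr Fa] [done [todo [rs' [D' [P' [adjE r16 [rep' Du'] [inv' sc']
    kE]]]]]].
  have r17 : reg s' 17 = arr s 0 u + size (adj u) by rewrite Fr.
  rewrite r16 r17 ltn_add2l adjE => lt.
  case: todo adjE inv' kE lt => [|w todo] adjE inv' kE lt.
    by move: lt; rewrite cats0 ltnn.
  have Fs' : framed (relax aD aP) s1 s' by [].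
  have Gs1 : graph_input s1 by [].
  have Gs' : graph_input s'.
    by apply: graph_input_framed Fs' _ _ _ Gs1; rewrite /= ?inE ?array_neqs.
  have uw : e u w by have [_ <-] := adjP u; rewrite adjE mem_cat mem_head orbT.
  have wE : arr s' 1 (reg s' 16) = w.
    have ltu : size done < size (adj u).
      by rewrite adjE size_cat /= addnS ltnS leq_addr.
    by rewrite r16 Fa ?inE ?array_neqs //= nbr // adjE nth_cat ltnn subnn.
  apply: runs_conseq (relax_spec Gs' _ _ _ wE uw rep' inv' sc') _.
  + by rewrite Fr.
  + by rewrite Fr.
  + by rewrite Fr // Du'.
  move=> t s2' _ [rs2 [D2 [P2 [rep2 inv2 sc2 Du2 [r16' t8]]]]].
  exists (9 * size todo); last by rewrite kE /=; lia.
  exists (rcons done w), todo, rs2, D2, P2; split=> //.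
  + by rewrite cat_rcons.
  + by rewrite r16' r16 size_rcons addnS.
  + by rewrite Du2.
move=> t s' [Fr Fa] [k [[done [todo [rs' [D' [P' [adjE r16 [rep' _] [inv' _]
  _]]]]]]]].
rewrite r16 Fr // /= adjE leq_add2l size_cat => le tk.
have todo0 : todo = [::] by case: (todo) le => //= *; lia.
exists rs', D', P'; rewrite todo0 in inv'; split=> //.
- by rewrite Fr //= r12.
- by rewrite Fr.
- by move: tk; lia.
Qed.

Lemma bfs_spec s (src : 'I_n) : graph_input s -> reg s 20 = src ->
  runs (bfs aD aP) s (fun t s' => exists D P u,
    [/\ bfs_tree e src D P, forall v, D v <= D u <= n,
        forall v, arr s' aD v = D v /\ arr s' aP v = P v,
        reg s' 14 = u /\ reg s' 15 = D u &
        t <= 13 * n + 9 * (\sum_v size (adj v)) + 12]).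
Proof.
move=> Gs r20; rewrite /bfs; do 3 step.
pose I1 k s' := [/\ reg s' 9 <= n, forall v, v < reg s' 9 -> arr s' aD v = 0
  & k = 3 * (n - reg s' 9)].
do 2 step.
apply: runs_conseq (@runs_while 9 0 _ I1 _ (3 * n) _ _) _.
- by split=> //=; rewrite subn0.
- move=> k s' [Fr Fa] [le9 clear kE].
  rewrite (Fr 0) //= (proj1 Gs) => lt.
  do 3 step; rewrite (Fr 10) //=; exists (3 * (n - (reg s' 9).+1)); last by lia.
  split=> //= v; rewrite ltnS leq_eqVlt eqxx /= => /orP[/eqP ->|vl].
    by rewrite eqxx.
  by case: eqP => // _; exact: clear.
move=> t1 s1 [Fr1 Fa1] [k1 [[le9 clear _] ge9 tk1]].
have r0 : reg s1 0 = n by rewrite Fr1 //= (proj1 Gs).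
have clear1 v : arr s1 aD v = 0.
  by apply: clear; apply: leq_trans ge9; rewrite r0.
have r20' : reg s1 20 = src by rewrite Fr1.
have r10' : reg s1 10 = 0 by rewrite Fr1.
have Gs1 : graph_input s1.
  split=> // v; have [_ /(_ v) [H0 H1]] := Gs.
  rewrite !Fa1 //= ?inE ?array_neqs //; split=> // k kv.
  by rewrite Fa1 //= ?inE ?array_neqs // H1.
do 13 step; rewrite r20' r10'.
set s2 := set_reg _ 13 1.
(* Each vertex not yet dequeued holds enough potential for its scan and the loop test. Register 14
   is meaningful only after the first dequeuing. *)
pose I2 k s' := exists u0 dn rs D P,
  [/\ reg s' 12 = size dn, represents s' (dn ++ rs) D P,
      bfs_inv e src u0 [::] dn rs D P,
      dn <> [::] -> reg s' 14 = last src dn &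
      k = \sum_(v | v \notin dn) (10 + 9 * size (adj v))].
apply: runs_conseq (@runs_while 12 13 _ I2 s2
  (\sum_v (10 + 9 * size (adj v))) _ _) _.
- exists src, [::], [:: src], (fun v => (v == src) : nat), (fun=> src).
  split=> //; last exact: bfs_inv_init.
  split=> //=.
  + move=> v; rewrite !array_neqs eqxx /= -val_eqE /=.
    by case: ifP => // _; rewrite clear1.
  + move=> v; rewrite !array_neqs eqxx /=.
    by case: eqVneq => // ->; rewrite eqxx.
  + by case=> // _; rewrite !array_neqs.
- move=> k s' Fs' [u0 [dn [rs [D [P [r12 rep inv last14 kE]]]]]].
  have [_ _ r13 _] := rep; rewrite r12 r13 size_cat => lt.
  case: rs rep inv lt r13 => [|u rs] rep inv lt r13.
    by move: lt; rewrite addn0 ltnn.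
  have Gs2 : graph_input s2.
    case: (Gs1) => ? H; split=> // v; have [H0 H1] := H v.
    by rewrite /= !array_neqs /=; split=> // j jv; rewrite !array_neqs /= H1.
  have Gs' : graph_input s'.
    by apply: graph_input_framed Fs' _ _ _ Gs2; rewrite /= ?inE ?array_neqs.
  have r11 : reg s' 11 = 1 by rewrite (proj1 Fs').
  apply: runs_conseq (scan_spec Gs' r11 r12 rep inv) _.
  move=> t s3 _ [rs' [D' [P' [rep' inv' r12' r14' t_le]]]].
  exists (\sum_(v | v \notin rcons dn u) (10 + 9 * size (adj v))).
    exists u, (rcons dn u), rs', D', P'; split=> //.
      by rewrite size_rcons.
    by rewrite last_rcons.
  rewrite kE [ltnRHS](bigD1 u) /=; last first.
    have := inv_uniq inv; rewrite cat_uniq /= negb_or.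
    by case/and3P=> _ /andP[].
  rewrite (eq_bigl (fun v => (v \notin dn) && (v != u))).
    by rewrite ltn_add2r; lia.
  by move=> v; rewrite mem_rcons inE negb_or andbC.
move=> t3 s3 Fs3 [k3 [[u0 [dn [rs [D [P [r12 rep inv last14 _]]]]]] ge tk3]].
have [sD sP r13 _] := rep.
have rs0 : rs = [::].
  by move: ge; rewrite r12 r13 size_cat; case: (rs) => //= *; lia.
rewrite rs0 in inv; have [tree far Dn dn0] := bfs_inv_final e_connected inv.
step; exists D, P, (last src dn); split=> //.
- by move=> v; rewrite far Dn.
- by move=> v; rewrite sD; split=> //; apply: sP; case: tree.
- by split; [rewrite last14|rewrite /= last14].
- move: tk1 tk3; rewrite big_split /= sum_nat_const card_ord -big_distrr /=.
  by lia.
Qed.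

End BFSProgram.

Lemma graph_input_init n (adj : 'I_n -> seq 'I_n) :
  graph_input adj (input_state adj).
Proof.
split=> // v.
pose lists := [seq [seq val w | w <- adj v] | v <- enum 'I_n].
have nthv : nth [::] lists v = [seq val w | w <- adj v].
  by rewrite (nth_map v) ?size_enum_ord // nth_ord_enum.
have sh : size (shape lists) = n by rewrite 2!size_map size_enum_ord.
have shv : nth 0 (shape lists) v = size (adj v).
  by rewrite (nth_map [::]) ?nthv 1?size_map 1?size_enum_ord.
split=> [|k kv].
  by rewrite /= -/lists (take_nth 0) ?sh // sumn_rcons shv.
rewrite /= -/lists nth_flatten.
have kv' : k < nth 0 (shape lists) v by rewrite shv.
have := flatten_indexKl kv'; have := flatten_indexKr kv'.
rewrite /flatten_index => -> ->; rewrite nthv (nth_map v) //.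
Qed.

(** * The two-center program *)

(** Further registers: 21 the current root [x], 22 the previous root [y],
    23 one more than [d(x,y)], 24 one more than the eccentricity of [x],
    25 a vertex furthest from [x]. *)
Definition sweep : cmd :=
  Move 23 24 ;; Move 22 21 ;; Move 21 25 ;; Move 20 25 ;; bfs 3 4 ;;
  Move 25 14 ;; Move 24 15.

(** The loop compares the eccentricities of two consecutive roots, so two sweeps come before its
    first test. *)
Definition find_mutually_distant : cmd := sweep ;; sweep ;; WhileLt 23 24 sweep.

(** Arrays 3 and 5 hold the labels from the two roots, so register 26 ends as [rho + 1]. *)
Definition max_min_label : cmd :=
  Const 26 0 ;; Const 9 0 ;;
  WhileLt 9 0
    (ReadCell 27 3 9 ;; ReadCell 28 5 9 ;;
     IfLt 27 28 Skip (Move 27 28) ;;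
     IfLt 26 27 (Move 26 27) Skip ;; Succ 9 9).

(** Register 26 holding [rho + 1], outputs from register [o] on the point at
    distance [rho / 2] from the vertex in register [x], on the way to the root
    of the tree with parents [aP]. *)
Definition climb (aP x o : nat) : cmd :=
  Move o x ;; Const 29 2 ;;
  WhileLt 29 26 (ReadCell o aP o ;; Succ 29 29 ;; Succ 29 29) ;;
  ReadCell o.+1 aP o ;;
  IfLt 26 29 (Const o.+2 0) (Const o.+2 1) ;;
  Const o.+3 2.

(** Each center is reached from one root by climbing the tree of the other. *)
Definition two_centers : cmd :=
  find_mutually_distant ;; Move 20 22 ;; bfs 5 6 ;; max_min_label ;;
  climb 6 21 1 ;; climb 4 22 5.

Lemma climb_spec n aP x o (s : state) (v : 'I_n) (P : 'I_n -> 'I_n) rho :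
  o < 21 -> x < 26 -> reg s x = v -> (forall u, arr s aP (val u) = P u) ->
  reg s 26 = rho.+1 ->
  runs (climb aP x o) s (fun t s' => exists k (a : nat),
    [/\ reg s' o = iter k P v, reg s' o.+1 = iter k.+1 P v,
        reg s' o.+2 = a /\ reg s' o.+3 = 2, (a <= 1) && (k.*2 + a == rho) &
        t <= 4 * rho + 20]).
Proof.
move=> o21 x26 xv par r26.
have neqs : ((o == 29) = false) * ((29 == o) = false) * ((26 == o) = false) *
    ((o.+1 == 29) = false) * ((26 == o.+1) = false) * ((29 == o.+1) = false) *
    ((o == o.+1) = false) * ((o == o.+2) = false) * ((o == o.+3) = false) *
    ((o.+1 == o.+2) = false) * ((o.+1 == o.+3) = false) *
    ((o.+2 == o.+3) = false).
  by do !split; lia.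
rewrite /climb; do 4 step.
set s1 := set_reg _ 29 2.
(* Starting register 29 at 2 makes the test say 2k + 2 <= rho. On exit rho is 2k or 2k + 1, and the
   final comparison tells which. *)
pose I k0 s' := exists k, [/\ reg s' 29 = 2 + k.*2, reg s' o = iter k P v,
  k.*2 <= rho & k0 = 4 * (rho - k.*2)].
step; apply: runs_conseq (@runs_while 29 26 _ I s1 (4 * rho) _ _) _.
- by exists 0; rewrite /= !neqs eqxx subn0 /=; split.
- move=> k0 s' [Fr Fa] [k [r29 ro kr k0E]].
  have r26' : reg s' 26 = rho.+1.
    by rewrite Fr /= ?inE ?neqs.
  rewrite r26' r29 => lt.
  do 5 step; exists (4 * (rho - k.+1.*2)); last by rewrite k0E doubleS; lia.
  exists k.+1; rewrite /= !neqs /= !eqxx; split=> //.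
  + by rewrite ?neqs /= r29 ?doubleS.
  + by rewrite Fa // ro par.
move=> t s' [Fr Fa] [k0 [[k [r29 ro kr _]] ge tk]].
have r26' : reg s' 26 = rho.+1 by rewrite Fr /= ?inE ?neqs.
rewrite r26' r29 in ge.
do 2 step; step; rewrite Fa // ro par.
apply: runs_if => /=; rewrite !neqs r26' r29 => cmp; do 2 step;
  rewrite !neqs !eqxx /= ?neqs.
  by exists k, 0; split=> //; [rewrite addn0; apply/eqP; lia|lia].
by exists k, 1; split=> //; [apply/eqP; lia|lia].
Qed.

Lemma max_min_label_spec n (s : state) (D1 D2 : 'I_n -> nat) :
  reg s 0 = n -> (forall v, arr s 3 (val v) = D1 v) ->
  (forall v, arr s 5 (val v) = D2 v) ->
  runs max_min_label s (fun t s' =>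
    [/\ forall v, minn (D1 v) (D2 v) <= reg s' 26,
        reg s' 26 = 0 \/ exists v, reg s' 26 = minn (D1 v) (D2 v) &
        t <= 10 * n + 3]).
Proof.
move=> r0 H1 H2; rewrite /max_min_label; do 4 step.
set s1 := set_reg _ 9 0.
pose I k s' := [/\ reg s' 9 <= n,
  forall v : 'I_n, v < reg s' 9 -> minn (D1 v) (D2 v) <= reg s' 26,
  reg s' 26 = 0 \/ exists v, reg s' 26 = minn (D1 v) (D2 v) &
  k = 10 * (n - reg s' 9)].
apply: runs_conseq (@runs_while 9 0 _ I s1 (10 * n) _ _) _.
- by split=> //=; [left|rewrite subn0].
- move=> k s' [Fr Fa] [le9 ub wit kE].
  rewrite (Fr 0) //= r0 => lt.
  pose v := Ordinal lt.
  have a3 : arr s' 3 (reg s' 9) = D1 v by rewrite Fa //= (H1 v).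
  have a5 : arr s' 5 (reg s' 9) = D2 v by rewrite Fa //= (H2 v).
  do 4 step; rewrite a3 a5.
  have ub' m : minn (D1 v) (D2 v) <= m -> reg s' 26 <= m ->
      forall w : 'I_n, w < (reg s' 9).+1 -> minn (D1 w) (D2 w) <= m.
    move=> vm rm w; rewrite ltnS leq_eqVlt => /orP[/eqP wv|/ub le].
      by have -> : w = v by exact: val_inj.
    exact: leq_trans le rm.
  step; apply: runs_if => /= lt1; step; step; apply: runs_if => /= lt2;
    do 2 step; exists (10 * (n - (reg s' 9).+1)); rewrite ?kE; try lia;
    split=> //=; try (apply: ub'; lia); try by [].
  + by right; exists v; lia.
  + by right; exists v; lia.
move=> t s' [Fr Fa] [k [[le9 ub wit kE] ge tk]].
split=> //; last by lia.
by move=> v; apply: ub; apply: leq_trans ge; rewrite (Fr 0) //= r0.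
Qed.

(** * The number of sweeps *)

Section Program.
Variables (R : realType) (n : nat) (e : rel 'I_n) (adj : 'I_n -> seq 'I_n).
Hypotheses (e_sym : symmetric e) (e_connected : connected_graph e).
Hypothesis adjP : adjacency_lists e adj.
Local Notation hop := (hop R e).

(** The bound for one search plus six register moves. *)
Definition sweep_cost := 13 * n + 9 * (\sum_v size (adj v)) + 18.

Definition swept (s : state) (x : 'I_n) : Prop := exists D P u,
  [/\ bfs_tree e x D P, forall v, D v <= D u <= n,
      forall v : 'I_n, arr s 3 v = D v /\ arr s 4 v = P v &
      [/\ graph_input adj s, reg s 21 = x, reg s 25 = u & reg s 24 = D u]].

Lemma sweep_spec (s : state) (z : 'I_n) : graph_input adj s -> reg s 25 = z ->
  runs sweep s (fun t s' => [/\ swept s' z, reg s' 22 = reg s 21,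
    reg s' 23 = reg s 24 & t <= sweep_cost]).
Proof.
move=> Gs r25; rewrite /sweep; do 9 step.
set s1 := set_reg _ 20 _.
have Gs1 : graph_input adj s1 by [].
have r20 : reg s1 20 = z by [].
apply: runs_conseq (bfs_spec e_connected adjP (aD := 3) (aP := 4) _ Gs1 r20) _.
  by [].
move=> t s' F [D [P [u [tree far arrs [r14 r15] t_le]]]]; do 3 step.
have [Fr _] := F.
split; [|by rewrite /= Fr|by rewrite /= Fr|by rewrite /sweep_cost; lia].
exists D, P, u; split=> //; split=> //=; last by rewrite Fr.
by apply: graph_input_framed F _ _ _ Gs1.
Qed.

Variables (delta : R).
Hypothesis thin : thin_triangles e delta.
Let slack := Num.truncn (2 * delta).

Lemma swept_hop s x : swept s x -> exists u : 'I_n,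
  [/\ reg s 25 = u, reg s 24 = (hop x u).+1 & forall v, hop x v <= hop x u].
Proof.
case=> D [P [u [tree far _ [_ _ r25 r24]]]]; exists u; split=> //.
  by rewrite r24 (bfs_tree_hop R e_sym e_connected u tree).
move=> v; have /andP[] := far v.
by rewrite !(bfs_tree_hop R e_sym e_connected _ tree) ltnS.
Qed.

Lemma find_mutually_distant_spec (s : state) (z : 'I_n) :
  graph_input adj s -> reg s 25 = z ->
  runs find_mutually_distant s (fun t s' => exists x y : 'I_n,
    [/\ swept s' x, reg s' 22 = y,
        (forall v, hop x v <= hop x y) /\ (forall v, hop y v <= hop y x) &
        t <= sweep_cost.+1 * (slack + 4)]).
Proof.
move=> Gs r25; rewrite /find_mutually_distant; step.
apply: runs_conseq (sweep_spec Gs r25) _ => t1 s1 _ [sw1 _ _ t1_le].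
have [x0 [r25_1 r24_1 far0]] := swept_hop sw1.
have [_ [_ [_ [_ _ _ [Gs1 r21_1 _ _]]]]] := sw1.
step; apply: runs_conseq (sweep_spec Gs1 r25_1) _ => t2 s2 _.
move=> [sw2 r22_2 r23_2 t2_le].

have [u2 [_ r24_2 far2]] := swept_hop sw2.
(* An upper bound on the diameter, since [x0] is furthest from [z] and [u2] from [x0]. *)
pose Delta := hop x0 u2 + slack.
have hop_le v w : hop v w <= Delta.
  apply: leq_trans (hop_le_furthest e_sym e_connected thin far0 v w) _.
  by rewrite leq_add2r geq_max !far2.
(* [m] bounds the sweeps left: while the loop continues it exceeds the gap between [Delta] and the
   eccentricity of [x], which has just grown. *)
pose I k s' := exists x y m,
  [/\ swept s' x, reg s' 22 = val y /\ reg s' 23 = (hop x y).+1,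
      forall v, hop y v <= hop y x,
      reg s' 23 < reg s' 24 -> Delta + 2 <= m + reg s' 24 &
      k = sweep_cost.+1 * m].
apply: runs_conseq (@runs_while 23 24 _ I s2 (sweep_cost.+1 * slack.+1) _ _) _.
- exists x0, z, slack.+1; split=> //.
    by rewrite r22_2 r21_1 r23_2 r24_1 hop_sym.
  by move=> _; rewrite r24_2 /Delta; lia.
- move=> k s3 _ [x [y [m [sw [r22 r23] far pot kE]]]] lt.
  have [u [r25' r24 farx]] := swept_hop sw.
  have [_ [_ [_ [_ _ _ [Gs3 r21 _ _]]]]] := sw.
  apply: runs_conseq (sweep_spec Gs3 r25') _ => t s4 _ [sw4 r22' r23' t_le].
  have [u' [_ r24' _]] := swept_hop sw4.
  have := pot lt; have := hop_le x u; rewrite r24 => le_u pot'.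
  exists (sweep_cost.+1 * m.-1).
    exists u, x, m.-1; split=> //.
      by rewrite r22' r23' r21 r24 hop_sym.
    by rewrite r23' r24; lia.
  have m0 : 0 < m by lia.
  by rewrite kE -[in ltnRHS](prednK m0) mulnS; lia.
move=> t3 s3 _ [k [[x [y [m [sw [r22 r23] far _ _]]]] ge tk]].
have [u [_ r24 farx]] := swept_hop sw.
exists x, y; split=> //.
  split=> // v; apply: leq_trans (farx v) _.
  by move: ge; rewrite r23 r24 ltnS.
by rewrite -[4]/(3.+1) -addSnnS mulnDr; lia.
Qed.

End Program.

(** * What the whole program computes, and its cost *)

Section Centers.
Variables (R : realType) (n : nat) (e : rel 'I_n) (adj : 'I_n -> seq 'I_n).
Hypotheses (e_sym : symmetric e) (e_connected : connected_graph e).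
Hypothesis adjP : adjacency_lists e adj.
Variables (delta : R).
Hypothesis thin : thin_triangles e delta.
Local Notation hop := (hop R e).

Definition center_registers (s : state) (o : nat) (v : 'I_n)
    (P : 'I_n -> 'I_n) (rho : nat) : Prop :=
  exists k (a : nat), [/\ reg s o = iter k P v, reg s o.+1 = iter k.+1 P v,
    reg s o.+2 = a /\ reg s o.+3 = 2 & (a <= 1) && (k.*2 + a == rho)].

Lemma two_centers_spec (s : state) (z : 'I_n) :
  graph_input adj s -> reg s 25 = z ->
  runs two_centers s (fun t s' => exists x y D1 P1 D2 P2 rho,
    [/\ (bfs_tree e x D1 P1 /\ bfs_tree e y D2 P2) /\
        ((forall v, hop x v <= hop x y) /\ (forall v, hop y v <= hop y x)),
        (forall v, minn (hop x v) (hop y v) <= rho) /\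
        (exists v, rho = minn (hop x v) (hop y v)),
        center_registers s' 1 x P2 rho, center_registers s' 5 y P1 rho &
        t <= (sweep_cost adj).+1 * (Num.truncn (2 * delta) + 8)]).
Proof.
move=> Gs r25; rewrite /two_centers; step.
apply: runs_conseq (find_mutually_distant_spec e_sym e_connected adjP thin Gs
  r25) _ => t1 s1 _ [x [y [sw1 r22 far t1_le]]].
have [D1 [P1 [u1 [tree1 D1n arrs1 [Gs1 r21 _ _]]]]] := sw1.
do 3 step; set s2 := set_reg s1 20 _.
have Gs2 : graph_input adj s2 by [].
have r20 : reg s2 20 = y by [].
apply: runs_conseq (bfs_spec e_connected adjP (aD := 5) (aP := 6) _ Gs2 r20) _.
  by [].
move=> t2 s3 F3 [D2 [P2 [u2 [tree2 D2n arrs2 _ t2_le]]]].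
have [Fr3 Fa3] := F3.
have Gs3 : graph_input adj s3 by apply: graph_input_framed F3 _ _ _ Gs2.
step; apply: runs_conseq (@max_min_label_spec n s3 D1 D2 (proj1 Gs3) _ _) _.
- by move=> v; rewrite Fa3 //; case: (arrs1 v).
- by move=> v; case: (arrs2 v).
move=> t3 s4 [Fr4 Fa4] [ub wit t3_le].
have D1h v := bfs_tree_hop R e_sym e_connected v tree1.
have D2h v := bfs_tree_hop R e_sym e_connected v tree2.
pose rho := (reg s4 26).-1.
(* Labels are positive, so register 26 is not left at 0 and the predecessor is exact. *)
have r26 : reg s4 26 = rho.+1 by have := ub x; rewrite D1h D2h /rho; lia.
have ub' v : minn (hop x v) (hop y v) <= rho.
  by have := ub v; rewrite r26 D1h D2h; lia.
have [w wE] : exists v, rho = minn (hop x v) (hop y v).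
  case: wit => [|[v vE]]; first by rewrite r26.
  by exists v; move: vE; rewrite r26 D1h D2h; lia.
have rho_n : rho <= n.
  by have := D1n w; rewrite wE !D1h; lia.
step; apply: runs_conseq (climb_spec (n := n) (aP := 6) (x := 21) (o := 1)
  (v := x) (P := P2) _ _ _ _ r26) _ => //.
- by rewrite Fr4 // Fr3.
- by move=> v; rewrite Fa4 //; case: (arrs2 v).
move=> t4 s5 [Fr5 Fa5] [k [a [o1 o2 o34 ka t4_le]]].
apply: runs_conseq (climb_spec (n := n) (aP := 4) (x := 22) (o := 5)
  (v := y) (P := P1) (rho := rho) _ _ _ _ _) _ => //.
- by rewrite Fr5 // Fr4 // Fr3.
- by move=> v; rewrite Fa5 // Fa4 // Fa3 //; case: (arrs1 v).
- by rewrite Fr5.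
move=> t5 s6 [Fr6 _] [k' [a' [o5 o6 o78 ka' t5_le]]].
exists x, y, D1, P1, D2, P2, rho; split=> //.
- by split=> //; exists w.
- by exists k, a; rewrite !Fr6.
- by exists k', a'.
(* Four further multiples of the sweep cost cover the second tree, the label scan and both climbs,
   which are linear as [rho <= n]. *)
- have -> : Num.truncn (2 * delta)%R + 8 = Num.truncn (2 * delta)%R + 4 + 4.
    by rewrite -addnA.
  rewrite mulnDr; move: t1_le t2_le; rewrite /sweep_cost; lia.
Qed.

End Centers.

(* Domination and running time together *)
Local Close Scope nat_scope.

Theorem theorem15 (R : realType) :
  exists (prog : cmd) (K : nat),
  forall (n : nat) (e : rel 'I_n) (delta r2 : R) (adj : 'I_n -> seq 'I_n),
    (0 < n)%N -> simple_graph e -> connected_graph e ->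
    hyperbolic e delta -> is_radius e 2 r2 ->
    adjacency_lists e adj ->
    exists (t : nat) (s : state) (c1 c2 : {ffun 'I_n -> R}),
      [/\ exec prog (input_state adj) t s,
          t%:R <= K%:R * (2 * delta + 1) * (num_edges e + n)%:R,
          output_point e s 1 c1 /\ output_point e s 5 c2,
          graph_points e c1 /\ graph_points e c2 &
          dominates e [set c1; c2] (r2 + delta)].
Proof.
(* 256 is 32 times 8: a sweep costs less than 32(m + n), where [n > 0] absorbs the constants, and
   the factor [Num.truncn (2 * delta) + 8] is at most 8(2 delta + 1). *)
exists two_centers, 256%N => n e delta r2 adj n0 simple conn [thin _] rad adjP.
have [e_sym e_irr] := simple.
case: n n0 e adj simple conn thin rad adjP e_sym e_irr => // n _ e adj simple
  conn thin rad adjP e_sym e_irr.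
(* The first root is vertex 0, as register 25 is initially 0. *)
have z0 : reg (input_state adj) 25 = val (ord0 : 'I_n.+1) by [].
have [t [s [run]]] := two_centers_spec e_sym conn adjP thin
  (graph_input_init adj) z0.
move=> [x [y [D1 [P1 [D2 [P2 [rho [[[tree1 tree2] [farx fary]] [ub [w wE]]
  C1 C2 t_le]]]]]]]].
have rho_r2 : rho%:R / 2 <= r2.
  by rewrite wE; apply: hop_radius2 => //; exact: farx.
have rho_xy : (rho <= hop R e x y)%N by rewrite wE geq_min farx.
(* One argument serves both centers, with the two roots exchanged. *)
have center o r v D P : bfs_tree e r D P -> center_registers s o v P rho ->
    (rho <= hop R e v r)%N -> (forall u, (hop R e r u <= hop R e r v)%N) ->
    exists c : {ffun 'I_n.+1 -> R}, [/\ output_point e s o c, graph_points e c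
      & forall u, (hop R e v u <= rho)%N ->
          dist e (vertex_point R u) c <= r2 + delta].
  move=> tree [k [a [o1 o2 [o3 o4] /andP[a1 /eqP kaE]]]] rv far.
  have step_ok := parent_step e_sym tree (iter k P v).
  exists (edge_point (iter k P v) (iter k.+1 P v) (a%:R / 2)); split.
  - exists (iter k P v), (iter k.+1 P v); split=> //.
      by rewrite o3 o4 (leq_trans a1).
    by rewrite o3 o4.
  - apply: edge_point_in_graph => //; apply/andP; split.
      by rewrite divr_ge0.
    by rewrite ler_pdivrMr // mul1r ler_nat (leq_trans a1).
  - move=> u vu; apply: le_trans (center_dominates e_sym conn thin tree a1 _ _
      (far u)) _; rewrite kaE //.
    by rewrite lerD2r.
have [c1 [out1 A1 dom1]] := center _ _ _ _ _ tree2 C1 rho_xy fary.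
have [|c2 [out2 A2 dom2]] := center _ _ _ _ _ tree1 C2 _ farx.
  by rewrite hop_sym.
exists t, s, c1, c2; split=> //.
  have d0 := delta_ge0 conn e_sym thin ord0.
  have deg := sum_degrees simple adjP.
  set N := (num_edges e + n.+1)%N.
  have cost : ((sweep_cost adj).+1 <= 32 * N)%N.
    by rewrite /sweep_cost /N; lia.
  have slack : (Num.truncn (2 * delta))%:R <= 2 * delta.
    by have /andP[] := truncn_itv (mulr_ge0 (ler0n R 2) d0).
  have : t%:R <= (32 * N * (Num.truncn (2 * delta) + 8))%:R :> R.
    by rewrite ler_nat; apply: leq_trans t_le _; rewrite leq_mul2r cost orbT.
  move/le_trans; apply; rewrite !natrM natrD [leRHS]mulrAC.
  have -> : 256%:R * N%:R * (2 * delta + 1) =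
    32%:R * N%:R * (8 * (2 * delta + 1)) :> R by ring.
  apply: ler_wpM2l; first by rewrite mulr_ge0.
  lra.
move=> u; have := ub u; rewrite geq_min => /orP[xu|yu].
  by exists c1; [left|exact: dom1].
by exists c2; [right|exact: dom2].
Qed.
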